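(* Let $X$ be a scheme (of finite type over a perfect field of characteristic $p>0$, or a localization or completion of such), let $\mathcal{L}$ be a line bundle on $X$, let $e>0$, and let $\kappa\colon F^e_*(\mathcal{F}\otimes\mathcal{L})\to\mathcal{F}$ be a coherent $(\mathcal{L},p^e)$-Cartier module. Then any chain of Cartier submodules of $\mathcal{F}$ \[ \cdots\supseteq \mathcal{F}_i\supseteq\mathcal{F}_{i+1}\supseteq\mathcal{F}_{i+2}\supseteq\cdots \] such that the structural map $\kappa_{\mathcal{F}_i}\colon F^e_*(\mathcal{F}_i\otimes\mathcal{L})\to\mathcal{F}_i$ of each $\mathcal{F}_i$ is surjective, is eventually constant (in both directions).
   Context: $F\colon X\to X$ is the absolute Frobenius. A (coherent) $(\mathcal{L},p^e)$-Cartier module is a coherent $\mathcal{O}_X$-module $\mathcal{F}$ with an $\mathcal{O}_X$-linear map $\kappa\colon F^e_*(\mathcal{F}\otimes\mathcal{L})\to\mathcal{F}$, called the structural map. A Cartier submodule is an $\mathcal{O}_X$-submodule $\mathcal{G}\subseteq\mathcal{F}$ with $\kappa(F^e_*(\mathcal{G}\otimes\mathcal{L}))\subseteq\mathcal{G}$; its structural map $\kappa_{\mathcal{G}}$ is the restriction of $\kappa$.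
   Formalization: The Cartier submodules F_i are assumed to be coherent O_X-submodules; for arbitrary, non-quasi-coherent O_X-submodules (such as extensions by zero from a decreasing sequence of open subsets of the affine line) the claim fails. *)

(* Defs.v *)
From HB Require Import structures.
From mathcomp Require Import all_boot all_order all_algebra.
From mathcomp Require Import all_classical topology.

Set Implicit Arguments.
Unset Strict Implicit.
Unset Printing Implicit Defensive.

Import GRing.Theory.
Local Open Scope classical_set_scope.
Local Open Scope ring_scope.

(** * Commutative algebra *)

(* Rings are [comPzRingType]s: the zero ring is allowed, since it is the ring
   of sections over the empty open set. *)

Definition is_ideal (A : comPzRingType) (I : set A) : Prop :=
  [/\ I 0, (forall a b, I a -> I b -> I (a + b))
    & (forall a b, I b -> I (a * b))].

Definition ideal_pow (A : comPzRingType) (I : set A) (n : nat) : set A :=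
  [set x | exists (m : nat) (c : 'I_m -> A) (y : 'I_m -> 'I_n -> A),
     (forall j t, I (y j t)) /\ x = \sum_j c j * \prod_t y j t].

Definition mult_closed (A : comPzRingType) (S : set A) : Prop :=
  S 1 /\ (forall s t, S s -> S t -> S (s * t)).

Definition powers (A : comPzRingType) (f : A) : set A :=
  range (fun n : nat => f ^+ n).

(* [g] exhibits [B] as the ring of fractions [S^-1 A]. *)
Definition is_localization (A B : comPzRingType) (S : set A)
    (g : {rmorphism A -> B}) : Prop :=
  [/\ (forall s, S s -> exists c, c * g s = 1),
      (forall b, exists a s, S s /\ b * g s = g a)
    & (forall a, g a = 0 -> exists2 s, S s & s * a = 0)].

(* [g] exhibits [B] as the [I]-adic completion [lim_n A / I^n] of [A]:
   [pi b n] is a representative in [A] of the component of [b] in [A / I^n]. *)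
Definition is_completion (A B : comPzRingType) (I : set A)
    (g : {rmorphism A -> B}) : Prop :=
  exists pi : B -> nat -> A,
    let eqI n a b := ideal_pow I n (a - b) in
    [/\ (forall b n, eqI n (pi b n.+1) (pi b n)),
        (forall a n, eqI n (pi (g a) n) a),
        (forall b c n, eqI n (pi (b + c) n) (pi b n + pi c n)),
        (forall b c n, eqI n (pi (b * c) n) (pi b n * pi c n))
      & (forall a : nat -> A, (forall n, eqI n (a n.+1) (a n)) ->
           exists! b, forall n, eqI n (pi b n) (a n))].

Definition is_finite_type (k : fieldType) (A : comPzRingType)
    (f : {rmorphism k -> A}) : Prop :=
  exists s : seq A, forall S : {pred A}, subring_closed S ->
    (forall c, f c \in S) -> {subset s <= S} -> forall a, a \in S.

(* The [k]-algebras obtained from those of finite type by localization and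
   completion (in any order, any finite number of times). *)
Inductive geometric_algebra (k : fieldType) :
    forall A : comPzRingType, (k -> A) -> Prop :=
| geometric_finite_type (A : comPzRingType) (f : {rmorphism k -> A}) :
    is_finite_type f -> geometric_algebra f
| geometric_localization (A B : comPzRingType) (f : k -> A)
    (S : set A) (g : {rmorphism A -> B}) :
    geometric_algebra f -> mult_closed S -> is_localization S g ->
    geometric_algebra (g \o f)
| geometric_completion (A B : comPzRingType) (f : k -> A)
    (I : set A) (g : {rmorphism A -> B}) :
    geometric_algebra f -> is_ideal I -> is_completion I g ->
    geometric_algebra (g \o f).

Definition perfect_field (p : nat) (k : fieldType) : Prop :=
  forall a : k, exists b : k, b ^+ p = a.

(** * Prime spectrum *)

Record Spec (A : comPzRingType) := MkSpec {
  prime_set :> set A;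
  prime_ideal : is_ideal prime_set;
  prime_proper : ~ prime_set 1;
  prime_prime : forall a b, prime_set (a * b) -> prime_set a \/ prime_set b }.

HB.instance Definition _ (A : comPzRingType) := gen_eqMixin (Spec A).
HB.instance Definition _ (A : comPzRingType) := gen_choiceMixin (Spec A).

Section Zariski.
Variable A : comPzRingType.

(* The closed sets are the [V(S)]. *)
Definition zariski_open (W : set (Spec A)) : Prop :=
  exists S : set A, W = [set q : Spec A | ~ (S `<=` q)].

Lemma zariski_openT : zariski_open [set: Spec A].
Proof.
exists setT; apply/seteqP; split=> // q _ /= h.
by apply: (prime_proper (s := q)); apply: h.
Qed.

Lemma zariski_openI : setI_closed zariski_open.
Proof.
move=> _ _ [S ->] [S' ->].
exists [set x | exists a b, [/\ S a, S' b & x = a * b]].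
apply/seteqP; split=> q /=.
- move=> [/existsNP [a /not_implyP [Sa qa]] /existsNP [b /not_implyP [Sb qb]]] h.
  by case: (prime_prime (h (a * b) _)) => //; exists a, b.
- move=> h; split=> h'; apply: h => _ [a [b [Sa Sb ->]]].
  + by case: (prime_ideal q) => _ _ hM; rewrite mulrC; apply: hM; apply: h'.
  + by case: (prime_ideal q) => _ _ hM; apply: hM; apply: h'.
Qed.

Lemma zariski_open_bigU (I : Type) (f : I -> set (Spec A)) :
  (forall i, zariski_open (f i)) -> zariski_open (\bigcup_i f i).
Proof.
move=> hf; exists [set a | exists2 S : set A, S a &
  exists i, f i = [set q : Spec A | ~ (S `<=` q)]].
apply/seteqP; split=> q /=.
- move=> [i _ fq] h; have [S fE] := hf i.
  move: fq; rewrite fE /=; apply=> a Sa; apply: h; exists S => //.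
  by exists i.
- move=> /existsNP [a /not_implyP [[S Sa [i fE]] qa]].
  by exists i => //; rewrite fE /= => h; apply: qa; apply: h.
Qed.

HB.instance Definition _ := @isOpenTopological.Build (Spec A)
  zariski_open zariski_openT zariski_openI zariski_open_bigU.

Definition basic_open (f : A) : set (Spec A) := [set q : Spec A | ~ prime_set q f].

Lemma open_basic_open f : open (basic_open f).
Proof.
exists [set f]; apply/seteqP; split=> q /= h.
- by move=> h'; apply: h; apply: h'.
- by move=> qf; apply: h => _ ->.
Qed.

End Zariski.

(** * Sheaves *)

Record opens (X : topologicalType) := Opens {
  oset :> set X;
  oset_open : open oset }.

Definition opens_top (X : topologicalType) : opens X := Opens (@openT X).

Section SheafAxioms.
Variables (X : topologicalType) (F : opens X -> Type).
Variable r : forall U V : opens X, V `<=` U -> F U -> F V.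

Definition presheaf_axiom : Prop :=
  (forall (U : opens X) (h : U `<=` U) s, r h s = s) /\
  (forall (U V W : opens X) (hUV : V `<=` U) (hVW : W `<=` V) (hUW : W `<=` U) s,
     r hVW (r hUV s) = r hUW s).

Definition sheaf_axiom : Prop :=
  forall (U : opens X) (I : Type) (V : I -> opens X) (hV : forall i, V i `<=` U),
    U `<=` \bigcup_i V i ->
  forall s : forall i, F (V i),
    (forall i j (W : opens X) (hi : W `<=` V i) (hj : W `<=` V j),
       r hi (s i) = r hj (s j)) ->
  exists! t : F U, forall i, r (hV i) t = s i.

End SheafAxioms.

Record ringed_space := RingedSpace {
  rs_top :> topologicalType;
  ssheaf : opens rs_top -> comPzRingType;
  sres : forall U V : opens rs_top, V `<=` U -> {rmorphism ssheaf U -> ssheaf V};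
  ssheaf_presheaf : presheaf_axiom (fun U V h => @sres U V h);
  ssheaf_sheaf : sheaf_axiom (fun U V h => @sres U V h) }.

Arguments ssheaf : clear implicits.

(** * Schemes *)

(* An isomorphism of ringed spaces from [Spec O(U)] to [U]: a homeomorphism of
   [Spec O(U)] onto [U] under which [O(D(f))] is [O(U)_f], by restriction. *)
Record affine_chart (X : ringed_space) (U : opens X) := AffineChart {
  chart :> Spec (ssheaf X U) -> X;
  chart_inj : injective chart;
  chart_range : range chart = U;
  chart_continuous : continuous chart;
  chart_open : forall W, open W -> open (chart @` W);
  chart_localization : forall (f : ssheaf X U) (V : opens X) (h : V `<=` U),
    oset V = chart @` basic_open f -> is_localization (powers f) (sres h) }.

Record scheme := Scheme {
  scheme_rs :> ringed_space;
  scheme_locally_affine : forall x : scheme_rs,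
    exists U : opens scheme_rs, oset U x /\ inhabited (affine_chart U) }.

Definition chart_basic (X : ringed_space) (U : opens X) (c : affine_chart U)
    (f : ssheaf X U) : opens X :=
  Opens (chart_open c (open_basic_open f)).

Lemma chart_basic_sub (X : ringed_space) (U : opens X) (c : affine_chart U) f :
  chart_basic c f `<=` U.
Proof. by rewrite -(chart_range c) => _ [q _ <-]; exists q. Qed.

Arguments chart_basic_sub {X U} c f.

(* [X] is a [k]-scheme glued from finitely many spectra of [k]-algebras that are
   of finite type, or localizations or completions of such.  When all the
   algebras are of finite type this says that [X] is of finite type over [k]. *)
Definition geometric_scheme (k : fieldType) (X : scheme)
    (f : {rmorphism k -> ssheaf X (opens_top X)}) : Prop :=
  exists (n : nat) (U : 'I_n -> opens X),
    [/\ [set: X] `<=` \bigcup_i U i,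
        (forall i, inhabited (affine_chart (U i)))
      & (forall i (h : U i `<=` opens_top X),
           geometric_algebra (fun a => sres h (f a)))].

(** * Modules over the structure sheaf *)

Record omodule (X : ringed_space) := OModule {
  msec :> forall U : opens X, lmodType (ssheaf X U);
  mres : forall U V : opens X, V `<=` U -> {additive msec U -> msec V};
  mresZ : forall (U V : opens X) (h : V `<=` U) a m,
    mres h (a *: m) = sres h a *: mres h m;
  msec_presheaf : presheaf_axiom (fun U V h => @mres U V h);
  msec_sheaf : sheaf_axiom (fun U V h => @mres U V h) }.

Arguments mres {X o U V} h.

Record omodule_hom (X : ringed_space) (M N : omodule X) := OModuleHom {
  hom_sec :> forall U : opens X, {linear M U -> N U};
  hom_res : forall (U V : opens X) (h : V `<=` U) m,
    hom_sec V (mres h m) = mres h (hom_sec U m) }.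

Record omodule_bilinear (X : ringed_space) (M N P : omodule X) :=
  OModuleBilinear {
  bil_sec :> forall U : opens X, M U -> N U -> P U;
  bil_linearl : forall U (n : N U), linear (fun m => bil_sec m n);
  bil_linearr : forall U (m : M U), linear (fun n => bil_sec m n);
  bil_res : forall (U V : opens X) (h : V `<=` U) m n,
    bil_sec (mres h m) (mres h n) = mres h (bil_sec m n) }.

(* The universal property defining the sheaf [M (x)_O N]. *)
Definition is_tensor (X : ringed_space) (M N T : omodule X)
    (b : omodule_bilinear M N T) : Prop :=
  forall (P : omodule X) (b' : omodule_bilinear M N P),
    exists u : omodule_hom T P,
      (forall U m n, u U (b U m n) = b' U m n) /\
      (forall u' : omodule_hom T P, (forall U m n, u' U (b U m n) = b' U m n) ->
         forall U t, u' U t = u U t).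

Definition line_bundle (X : ringed_space) (L : omodule X) : Prop :=
  forall x : X, exists (U : opens X) (s : L U), oset U x /\
    forall (V : opens X) (h : V `<=` U),
      bijective (fun a : ssheaf X V => a *: mres h s).

(* Submodules of [M] are families [G] of subsets of the [M U]. *)
Definition is_submodule (X : ringed_space) (M : omodule X)
    (G : forall U : opens X, set (M U)) : Prop :=
  [/\ (forall U, G U 0),
      (forall U a m n, G U m -> G U n -> G U (a *: m + n)),
      (forall (U V : opens X) (h : V `<=` U) m, G U m -> G V (mres h m))
    & (forall (U : opens X) (m : M U),
         (forall x, oset U x -> exists (V : opens X) (h : V `<=` U),
            oset V x /\ G V (mres h m)) -> G U m)].

(* Coherence of the submodule [G] of [M] over a locally noetherian scheme:
   [X] is covered by affine [U] such that [G(U)] is finitely generated and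
   [G(D(f)) = G(U)_f] for all [f] in [O(U)], that is, [G] restricted to [U] is
   the sheaf associated with [G(U)].  Invertibility of [f] on [G(D(f))] is
   automatic. *)
Definition coherent_sub (X : ringed_space) (M : omodule X)
    (G : forall U : opens X, set (M U)) : Prop :=
  forall x : X, exists (U : opens X) (c : affine_chart U),
    [/\ oset U x,
        (exists (n : nat) (g : 'I_n -> M U), (forall i, G U (g i)) /\
           forall m, G U m -> exists a : 'I_n -> ssheaf X U,
             m = \sum_i a i *: g i),
        (forall f (y : M (chart_basic c f)), G (chart_basic c f) y ->
           exists (n : nat) (m : M U), G U m /\
             sres (chart_basic_sub c f) (f ^+ n) *: y
               = mres (chart_basic_sub c f) m)
      & (forall f (m : M U), G U m -> mres (chart_basic_sub c f) m = 0 ->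
           exists n : nat, f ^+ n *: m = 0)].

Definition coherent (X : ringed_space) (M : omodule X) : Prop :=
  coherent_sub (fun U => [set: M U]).

(** * Frobenius *)

Definition frobenius (p e : nat) (A : comPzRingType) (a : A) : A := a ^+ (p ^ e).

Section FrobeniusMorphism.
Variables (p e : nat) (A : comPzRingType).
Hypotheses (p_prime : prime p) (pA : p%:R = 0 :> A).

Lemma exprDp (x y : A) : (x + y) ^+ p = x ^+ p + y ^+ p.
Proof.
have p0 := prime_gt0 p_prime; have hp := p_prime.
case: p p0 hp pA => // q _ hp hA.
rewrite exprDn big_ord_recl big_ord_recr /= subn0 subnn !expr0 mulr1 mul1r.
rewrite bin0 binn !mulr1n big1 ?add0r // => i _.
have /dvdnP [c ->] : (q.+1 %| 'C(q.+1, bump 0 i))%N.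
  by apply: prime_dvd_bin => //; rewrite /bump /= add1n ltnS ltn_ord.
by rewrite mulnC mulrnA -[in X in X *+ c]mulr_natr hA mulr0 mul0rn.
Qed.

Lemma frobenius_is_additive : zmod_morphism (@frobenius p e A).
Proof.
suff hD x y : (x + y) ^+ (p ^ e) = x ^+ (p ^ e) + y ^+ (p ^ e) :> A.
  move=> x y; rewrite /frobenius; apply/eqP.
  by rewrite eq_sym subr_eq -hD subrK.
by elim: e => [|n IH]; rewrite ?expn0 ?expr1 // expnSr !exprM IH exprDp.
Qed.

Lemma frobenius_is_multiplicative : monoid_morphism (@frobenius p e A).
Proof.
by split=> [|x y]; rewrite /frobenius ?expr1n // exprMn_comm //; apply: mulrC.
Qed.

Definition frobenius_rmorphism : {rmorphism A -> A} :=
  HB.pack (@frobenius p e A)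
    (GRing.isZmodMorphism.Build A A _ frobenius_is_additive)
    (GRing.isMonoidMorphism.Build A A _ frobenius_is_multiplicative).

End FrobeniusMorphism.

Definition restriction_of_scalars (R S : comPzRingType) (f : {rmorphism R -> S})
  (M : lmodType S) : Type := M.

Section RestrictionOfScalars.
Variables (R S : comPzRingType) (f : {rmorphism R -> S}) (M : lmodType S).
Local Notation M' := (restriction_of_scalars f M).

HB.instance Definition _ := GRing.Zmodule.copy M' (M : zmodType).

Definition ros_scale (a : R) (m : M') : M' := f a *: (m : M).

Lemma ros_scaleA a b v : ros_scale a (ros_scale b v) = ros_scale (a * b) v.
Proof. by rewrite /ros_scale scalerA rmorphM. Qed.
Lemma ros_scale1 : left_id 1 ros_scale.
Proof. by move=> v; rewrite /ros_scale rmorph1 scale1r. Qed.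
Lemma ros_scaleDr : right_distributive ros_scale +%R.
Proof. by move=> a u v; apply: scalerDr. Qed.
Lemma ros_scaleDl v : {morph ros_scale^~ v : a b / a + b}.
Proof. by move=> a b; rewrite /ros_scale rmorphD; apply: scalerDl. Qed.

HB.instance Definition _ := GRing.Zmodule_isLmodule.Build R M'
  ros_scaleA ros_scale1 ros_scaleDr ros_scaleDl.

End RestrictionOfScalars.

Definition char_space (p : nat) (X : ringed_space) : Prop :=
  prime p /\ forall U : opens X, p%:R = 0 :> ssheaf X U.

Lemma char_space_of_field (p : nat) (k : fieldType) (X : ringed_space)
    (f : {rmorphism k -> ssheaf X (opens_top X)}) :
  p \in [pchar k] -> char_space p X.
Proof.
move=> /andP [hp /eqP hk]; split=> // U.
have h : U `<=` opens_top X by [].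
by rewrite -(rmorph_nat (sres h)) -(rmorph_nat f) hk !rmorph0.
Qed.

Section Pushforward.
Variables (p : nat) (X : ringed_space) (hX : char_space p X) (e : nat).
Variable M : omodule X.

(* [F^e] is the identity on points, so [F^e_* M] has the sections of [M], with
   scalars acting through the [p^e]-th power map. *)
Definition frob_sec (U : opens X) : lmodType (ssheaf X U) :=
  restriction_of_scalars (frobenius_rmorphism e hX.1 (hX.2 U)) (M U).

Definition frob_res (U V : opens X) (h : V `<=` U) :
  {additive frob_sec U -> frob_sec V} := mres h : {additive M U -> M V}.

Lemma frob_resZ (U V : opens X) (h : V `<=` U) a m :
  frob_res h (a *: m) = sres h a *: frob_res h m.
Proof.
transitivity (mres h (a ^+ (p ^ e) *: (m : M U))); first by [].
by rewrite mresZ rmorphXn.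
Qed.

Definition frob_pushforward : omodule X :=
  @OModule X frob_sec frob_res frob_resZ
    (@msec_presheaf X M) (@msec_sheaf X M).

End Pushforward.

(** * Cartier modules *)

Record cartier_module (p : nat) (X : ringed_space) (hX : char_space p X)
    (L : omodule X) (e : nat) := CartierModule {
  cm_mod :> omodule X;
  cm_coherent : coherent cm_mod;
  cm_tensor : omodule X;
  cm_pure : omodule_bilinear cm_mod L cm_tensor;
  cm_tensorP : is_tensor cm_pure;
  cm_str : omodule_hom (frob_pushforward hX e cm_tensor) cm_mod }.

Section CartierSubmodule.
Variables (p : nat) (X : ringed_space) (hX : char_space p X).
Variables (L : omodule X) (e : nat) (M : cartier_module hX L e).
Variable G : forall U : opens X, set (M U).

(* [G (x) L] as a submodule of [M (x) L], that is, the image of the canonical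
   map between these sheaves, which is injective when [L] is a line bundle. *)
Definition tensor_sub (U : opens X) : set (cm_tensor M U) :=
  [set t | forall x, oset U x -> exists (V : opens X) (h : V `<=` U), oset V x /\
     exists (n : nat) (g : 'I_n -> M V) (l : 'I_n -> L V),
       (forall i, G (g i)) /\ mres h t = \sum_i cm_pure M V (g i) (l i)].

Definition cartier_submodule : Prop :=
  [/\ is_submodule G, coherent_sub G
    & forall (U : opens X) t, tensor_sub (U := U) t -> G (cm_str M U t)].

(* Surjectivity of the restriction [F^e_*(G (x) L) -> G] of the structural map,
   as a morphism of sheaves. *)
Definition cartier_sub_surjective : Prop :=
  forall (U : opens X) (g : M U), G g -> forall x, oset U x ->
    exists (V : opens X) (h : V `<=` U) (t : cm_tensor M V),
      [/\ oset V x, tensor_sub t & cm_str M V t = mres h g].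

End CartierSubmodule.

(* Main.v *)
Require Import Defs.
From HB Require Import structures.
From mathcomp Require Import all_boot all_order all_algebra.
From mathcomp Require Import all_classical topology.
From mathcomp Require Import ring zify.

Set Implicit Arguments.
Unset Strict Implicit.
Unset Printing Implicit Defensive.

Import GRing.Theory.
Local Open Scope classical_set_scope.
Local Open Scope ring_scope.

(** The question is local, and [X] is quasi-compact: every point has an affine
    neighbourhood [D] on which [L] is trivial, [M] comes from a finitely
    generated module [M(D)] over [R = O(D)], and [R] is noetherian and finite
    over its p-th powers ([good_neighbourhood]). The ring-theoretic properties
    pass from the perfect field [k] through algebras of finite type (Hilbert's
    theorem, [hilbert_basis]), localizations and completions
    ([geometric_algebra_noetherian_ffinite]). With [q = p ^ e], a generator of
    [L] turns the structural map into an additive [kappa : M(D) -> M(D)] with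
    [kappa (a^q m) = a kappa m], and the members of the chain into submodules
    [N_i] with [kappa N_i = N_i] ([trivialized_onto]). This uses that each of
    them is quasi-coherent on [D] although it is only given as coherent on a
    cover depending on it ([extends_local]).

    Ascending chains stop because [M(D)] is noetherian. For a descending chain
    ([cartier_chain_stationary]) let [J] be the ideal of all [a] such that
    [a N_0] lies in all [N_i]. As [kappa] is onto, [J] is radical. If it is
    proper, let [P = (J : c)] be an associated prime. It suffices to find [i]
    and an [s] outside [P] with [s N_i] inside all [N_n]: then passing to the
    chain that starts at [N_i] enlarges [J], and noetherian induction applies.

    At [P] the members of the chain become subspaces of a finite-dimensional
    vector space, so they agree from some [i] on ([rank_stable]); but the
    denominators still depend on [n]. Put [B = N_i] and divide by its largest
    part [W] on which [kappa] is nilpotent at [P]; then [w |-> kappa (_ w)] is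
    injective near [P]. Near [P], [R / P] is free over its q-th powers, with
    basis [x_j] say; comparing dimensions, every additive map [h] from [R] to [B]
    with [h (a^q b) = a h(b)] is of the form [kappa (_ w)], in particular every
    coordinate function with respect to the [x_j] times an element of [B]
    ([dual_basis]). Now let [N]
    be a [kappa]-stable submodule with [d B] inside [N] for some [d] outside
    [P], and [I] the ideal of multipliers of [B] into [N]. Applying [kappa] to
    [z w] for [z] in [I] shows that the coordinates of [z] are again in [I], up
    to a factor that does not depend on [N]. Hence some [sigma] outside [P],
    also independent of [N], multiplies [I] into [I^2 + P], and Nakayama's lemma
    puts a power of [sigma] into [I] ([test_element]). Surjectivity of [kappa]
    reduces the exponent to one and removes [W] ([generic_stable]).

    The dimension counts rest on [R] being finite over its q-th powers: a
    finitely generated module over a domain is generically free. *)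


(** * Chain conditions for groups with operators *)

(** The ambient group carries a set of operators instead of a module
    structure, because the same chain conditions are needed for modules over
    several rings on one group. *)
Definition opsub (V : zmodType) (Om : set (V -> V)) (N : set V) : Prop :=
  [/\ N 0, (forall x y, N x -> N y -> N (x - y))
    & (forall w x, Om w -> N x -> N (w x))].

Definition acc (V : zmodType) (Om : set (V -> V)) (B : set V) : Prop :=
  forall J : nat -> set V, (forall n, opsub Om (J n)) ->
    (forall n, J n `<=` J n.+1) -> (forall n, J n `<=` B) ->
    exists n, forall m, J m `<=` J n.

Lemma chain_le (T : Type) (J : nat -> set T) :
  (forall n, J n `<=` J n.+1) -> forall m n, (m <= n)%N -> J m `<=` J n.
Proof.
move=> h m n /subnK <-; elim: (n - m)%N => [|k IH] //.
by apply: subset_trans IH _; apply: h.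
Qed.

Section OpSub.
Variables (V : zmodType) (Om : set (V -> V)).
Implicit Types N : set V.

Lemma opsubN N x : opsub Om N -> N x -> N (- x).
Proof. by case=> h0 hB _ hx; rewrite -sub0r; apply: hB. Qed.

Lemma opsubD N x y : opsub Om N -> N x -> N y -> N (x + y).
Proof.
move=> hN hx hy; rewrite -(opprK y); case: (hN) => _ hB _.
by apply: hB => //; apply: opsubN.
Qed.

Lemma opsub_sum N (I : Type) (r : seq I) (P : pred I) (F : I -> V) :
  opsub Om N -> (forall i, P i -> N (F i)) -> N (\sum_(i <- r | P i) F i).
Proof.
move=> hN hF; apply: (big_ind N) => //; first by case: hN.
by move=> x y; apply: opsubD.
Qed.

Lemma opsubI N1 N2 : opsub Om N1 -> opsub Om N2 -> opsub Om (N1 `&` N2).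
Proof.
move=> [h0 hB hW] [h0' hB' hW']; split.
- by split.
- by move=> x y [? ?] [? ?]; split; [apply: hB | apply: hB'].
- by move=> w x Ow [? ?]; split; [apply: hW | apply: hW'].
Qed.

Lemma acc_sub (B B' : set V) : B' `<=` B -> acc Om B -> acc Om B'.
Proof. by move=> sB hB J h1 h2 h3; apply: hB => // n x /h3 /sB. Qed.

(** A family without maximal member would, by choice, contain a strictly
    increasing chain. *)
Lemma acc_max (B : set V) (F : set (set V)) :
  acc Om B -> (forall N, F N -> opsub Om N /\ N `<=` B) -> (exists N, F N) ->
  exists2 N, F N & forall N', F N' -> N `<=` N' -> N' `<=` N.
Proof.
move=> hB hF [N0 FN0]; apply: contrapT => hno.
have next N : exists N', F N -> [/\ F N', N `<=` N' & ~ (N' `<=` N)].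
  have [FN|nFN] := pselect (F N); last by exists N.
  apply: contrapT => h; apply: hno; exists N => // N' FN' sNN'.
  by apply: contrapT => h'; apply: h; exists N' => _.
have [s hs] := choice next.
pose J n := iter n s N0.
have FJ n : F (J n) by elim: n => //= n IH; case: (hs _ IH).
have sJ n : J n `<=` J n.+1 by case: (hs _ (FJ n)).
have [n hn] := hB J (fun n => (hF _ (FJ n)).1) sJ (fun n => (hF _ (FJ n)).2).
by case: (hs _ (FJ n)) => _ _; apply; apply: (hn n.+1).
Qed.

(** This provides common denominators: the elements with a given denominator
    form a submodule, and these submodules are directed. *)
Lemma acc_directed (B : set V) (I : Type) (D : set I) (N : I -> set V) :
  acc Om B -> (exists i, D i) ->
  (forall i, D i -> opsub Om (N i) /\ N i `<=` B) ->
  (forall i j, D i -> D j ->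
     exists k, [/\ D k, N i `<=` N k & N j `<=` N k]) ->
  exists2 i, D i & forall j, D j -> N j `<=` N i.
Proof.
move=> hB [i0 Di0] hN hdir.
have [||_ [i Di <-] hmax] := @acc_max B [set N i | i in D] hB.
- by move=> _ [i Di <-]; apply: hN.
- by exists (N i0); exists i0.
exists i => // j Dj; have [k [Dk sik sjk]] := hdir i j Di Dj.
by apply: (subset_trans sjk); apply: hmax => //; exists k.
Qed.

End OpSub.

(** ** Hilbert's basis theorem *)

Section Hilbert.
Variables (V : zmodType) (Om : set (V -> V)) (B : set V) (s : {additive V -> V}).
Hypothesis subB : opsub Om B.
Hypothesis s_comm : forall w x, Om w -> w (s x) = s (w x).
Hypothesis w_add : forall w x y, Om w -> w (x + y) = w x + w y.

Definition poly_lt (d : nat) : set V :=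
  [set x | exists2 b : nat -> V, (forall i, B (b i)) &
     x = \sum_(0 <= i < d) iter i s (b i)].

Definition poly_all : set V := [set x | exists d, poly_lt d x].

Definition lead (J : set V) (d : nat) : set V :=
  [set b | B b /\ exists2 r, poly_lt d r & J (iter d s b + r)].

Let iter_additive n : zmod_morphism (iter n s).
Proof. by elim: n => // n IH x y /=; rewrite IH raddfB. Qed.

Let w0 w : Om w -> w 0 = 0.
Proof.
by move=> Ow; apply: (addrI (w 0)); rewrite -w_add // !addr0.
Qed.

Let iter_comm n w x : Om w -> w (iter n s x) = iter n s (w x).
Proof. by move=> Ow; elim: n => //= n IH; rewrite s_comm // IH. Qed.

Lemma poly_lt_opsub d : opsub Om (poly_lt d).
Proof.
case: subB => B0 BB BW; split.
- exists (fun=> 0) => //; rewrite big1 // => i _.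
  by elim: i => //= i ->; rewrite raddf0.
- move=> _ _ [b hb ->] [c hc ->]; exists (fun i => b i - c i) => [i|].
    exact: BB.
  by rewrite -sumrB; apply: eq_bigr => i _; rewrite iter_additive.
- move=> w _ Ow [b hb ->]; exists (fun i => w (b i)) => [i|]; first exact: BW.
  rewrite (big_morph w (fun x y => w_add x y Ow) (w0 Ow)).
  by apply: eq_bigr => i _; rewrite iter_comm.
Qed.

Lemma poly_lt_le d d' : (d <= d')%N -> poly_lt d `<=` poly_lt d'.
Proof.
move=> dd' _ [b hb ->]; exists (fun i => if (i < d)%N then b i else 0) => [i|].
  by case: ifP => // _; case: subB.
rewrite (big_cat_nat (leq0n d) dd') /= [X in _ + X]big_nat_cond [X in _ + X]big1 ?addr0.
  by apply: eq_big_nat => i /andP[_ ->].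
move=> i /andP[/andP[di _] _]; rewrite ltnNge di /=.
by elim: i {di} => //= i ->; rewrite raddf0.
Qed.

Lemma poly_ltS d x : poly_lt d x -> poly_lt d.+1 (s x).
Proof.
move=> [b hb ->]; exists (fun i => if i is i'.+1 then b i' else 0).
  by case: subB => B0 _ _ [].
rewrite big_nat_recl //= add0r raddf_sum; by apply: eq_bigr.
Qed.

Lemma poly_all_opsub : opsub (Om `|` [set (s : V -> V)]) poly_all.
Proof.
split.
- by exists 0%N; case: (poly_lt_opsub 0).
- move=> x y [d px] [d' py]; exists (maxn d d').
  case: (poly_lt_opsub (maxn d d')) => _ + _; apply.
  + exact: (poly_lt_le (leq_maxl d d') px).
  + exact: (poly_lt_le (leq_maxr d d') py).
- move=> w x [Ow|->] [d px]; last by exists d.+1; apply: poly_ltS.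
  by exists d; case: (poly_lt_opsub d) => _ _; apply.
Qed.

Lemma sub_poly_all : B `<=` poly_all.
Proof.
move=> b Bb; exists 1%N; exists (fun i => if i is 0%N then b else 0).
  by case: subB => B0 _ _ [].
by rewrite big_nat1.
Qed.

Lemma lead_opsub J d : opsub Om J -> opsub Om (lead J d).
Proof.
move=> hJ; case: subB => B0 BB BW; have [P0 PB PW] := poly_lt_opsub d.
case: (hJ) => J0 JB JW; split.
- split => //; exists 0 => //; rewrite addr0.
  by have := iter_additive d 0 0; rewrite !subr0 subrr => ->.
- move=> x y [Bx [r Pr Jx]] [By [r' Pr' Jy]]; split; first exact: BB.
  exists (r - r'); first exact: PB.
  rewrite iter_additive.
  have -> : iter d s x - iter d s y + (r - r')
    = iter d s x + r - (iter d s y + r') by rewrite opprD addrACA.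
  exact: JB.
- move=> w x Ow [Bx [r Pr Jx]]; split; first exact: BW.
  exists (w r); first exact: PW.
  by rewrite -iter_comm // -w_add //; apply: JW.
Qed.

Lemma lead_mono J d : (forall x, J x -> J (s x)) -> lead J d `<=` lead J d.+1.
Proof.
move=> hs b [Bb [r Pr Jr]]; split => //; exists (s r); first exact: poly_ltS.
by rewrite /= -raddfD; apply: hs.
Qed.

(** A polynomial of [J'] is reduced to zero by subtracting, from the top
    degree down, elements of [J] with the same leading coefficient. *)
Lemma lead_inj J J' : opsub Om J -> opsub Om J' -> J `<=` J' ->
  J' `<=` poly_all -> (forall d, lead J' d `<=` lead J d) -> J' `<=` J.
Proof.
move=> hJ hJ' sJ J'p hl x J'x; have [d pd] := J'p x J'x.
elim: d x pd J'x => [|d IH] x [b hb ->].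
  by rewrite big_geq // => _; case: hJ.
rewrite big_nat_recr //= addrC => J'x.
have [|_ [r Pr Jr]] := hl d (b d).
  by split => //; exists (\sum_(0 <= i < d) iter i s (b i)) => //; exists b.
set y := \sum_(_ <= _ < _) _ in J'x *.
have -> : iter d s (b d) + y = (iter d s (b d) + r) + (y - r).
  by rewrite -addrA (addrC r) subrK.
apply: (opsubD hJ Jr); apply: IH.
- by case: (poly_lt_opsub d) => _ PB _; apply: PB => //; exists b.
- have -> : y - r = (iter d s (b d) + y) - (iter d s (b d) + r).
    by rewrite [in RHS]opprD [RHS]addrACA subrr add0r.
  by case: hJ' => _ JB _; exact: JB J'x (sJ _ Jr).
Qed.

Theorem hilbert_basis : acc Om B -> acc (Om `|` [set (s : V -> V)]) poly_all.
Proof.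
move=> accB J hJ sJ Jp.
have hJO n : opsub Om (J n).
  by case: (hJ n) => h0 hB hW; split => // w x Ow; apply: hW; left.
have Js n x : J n x -> J n (s x).
  by case: (hJ n) => _ _ hW; apply: hW; right.
have Lm n m d : (n <= m)%N -> lead (J n) d `<=` lead (J m) d.
  move=> nm b [Bb [r Pr Jr]]; split => //; exists r => //.
  exact: (chain_le sJ nm).
have Ld n d d' : (d <= d')%N -> lead (J n) d `<=` lead (J n) d'.
  by apply: (@chain_le _ (lead (J n))) => k; apply: lead_mono => x; apply: Js.
have LB n d : lead (J n) d `<=` B by move=> b [].
(* The diagonal takes care of the high degrees, and each of the finitely many
   low degrees is handled separately. *)
have [n0 hn0] : exists n, forall m, lead (J m) m `<=` lead (J n) n.
  apply: (accB (fun n => lead (J n) n)) => // n; first exact: lead_opsub.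
  exact: subset_trans (Lm n n.+1 n _) (Ld n.+1 n n.+1 _).
have [N hN] : exists N, forall d, (d < n0)%N -> forall m,
    lead (J m) d `<=` lead (J N) d.
  elim: (n0) => [|k [N hN]]; first by exists 0%N.
  have [n hn] := accB (fun n => lead (J n) k) (fun n => lead_opsub k (hJO n))
    (fun n => Lm n n.+1 k (leqnSn n)) (fun n => @LB n k).
  exists (maxn N n) => d; rewrite ltnS leq_eqVlt => /orP[/eqP->|dk] m.
    by apply: subset_trans (hn m) _; apply: Lm; apply: leq_maxr.
  by apply: subset_trans (hN d dk m) _; apply: Lm; apply: leq_maxl.
exists (maxn n0 N) => m.
have [mn|/ltnW nm] := leqP m (maxn n0 N); first exact: chain_le.
apply: lead_inj => //; first exact: chain_le.
move=> d; have [n0d|dn0] := leqP n0 d.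
  apply: (@subset_trans _ (lead (J (maxn m d)) (maxn m d))).
    apply: subset_trans (Ld _ _ _ (leq_maxr m d)).
    by apply: Lm; apply: leq_maxl.
  apply: subset_trans (hn0 _) _; apply: subset_trans (Ld _ _ _ n0d) _.
  by apply: Lm; apply: leq_maxl.
by apply: subset_trans (hN d dn0 m) _; apply: Lm; apply: leq_maxr.
Qed.

End Hilbert.

(** ** Noetherian modules and rings *)

Section Modules.
Variables (R : comPzRingType) (V : lmodType R).
Implicit Types N B : set V.

Definition scalings : set (V -> V) := range (fun a : R => *:%R a).

Definition submod N : Prop := opsub scalings N.

Lemma submodP N : submod N <->
  [/\ N 0, (forall x y, N x -> N y -> N (x + y))
    & (forall a x, N x -> N (a *: x))].
Proof.
split=> [hN|[h0 hD hZ]].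
  split; [by case: hN | by move=> x y; apply: (opsubD hN)|].
  by move=> a x; case: hN => _ _ h; apply: h; exists a.
split=> //; last by move=> _ x [a _ <-]; apply: hZ.
by move=> x y Nx Ny; apply: hD => //; rewrite -scaleN1r; apply: hZ.
Qed.

Lemma submodZ N a x : submod N -> N x -> N (a *: x).
Proof. by move=> /submodP [_ _]; apply. Qed.

Lemma submod_comb N (I : Type) (r : seq I) (a : I -> R) (g : I -> V) :
  submod N -> (forall i, N (g i)) -> N (\sum_(i <- r) a i *: g i).
Proof. by move=> hN hg; apply: (opsub_sum _ hN) => i _; apply: submodZ. Qed.

Definition macc B : Prop := acc scalings B.

Lemma macc_fg B N : macc B -> submod N -> N `<=` B ->
  exists n (g : 'I_n -> V), (forall i, N (g i)) /\
    forall m, N m -> exists a : 'I_n -> R, m = \sum_i a i *: g i.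
Proof.
move=> hB hN sN.
pose span n (g : nat -> V) : set V :=
  [set m | exists a : nat -> R, m = \sum_(0 <= i < n) a i *: g i].
have [||_ [n [g [Ng ->]]] hmax] := @acc_max V scalings B
  [set N' | exists n (g : nat -> V), (forall i, N (g i)) /\ N' = span n g] hB.
- move=> _ [n [g [Ng ->]]]; split; last first.
    by move=> _ [a ->]; apply: sN; apply: submod_comb.
  apply/submodP; split.
  + by exists (fun=> 0); rewrite big1 // => i _; rewrite scale0r.
  + move=> _ _ [a ->] [b ->]; exists (fun i => a i + b i).
    by rewrite -big_split; apply: eq_bigr => i _; rewrite scalerDl.
  + move=> c _ [a ->]; exists (fun i => c * a i).
    by rewrite scaler_sumr; apply: eq_bigr => i _; rewrite scalerA.
- by exists (span 0%N (fun=> 0)); exists 0%N, (fun=> 0); split=> // _; case: hN.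
exists n, (fun i => g i); split=> // m Nm.
pose g' i := if i == n then m else g i.
have g'E (a : nat -> R) :
    \sum_(0 <= i < n) a i *: g' i = \sum_(0 <= i < n) a i *: g i.
  by apply: eq_big_nat => i /andP[_ ilt]; rewrite /g' ltn_eqF.
have : span n g m.
  apply: (hmax (span n.+1 g')).
  - by exists n.+1, g'; split=> // i; rewrite /g'; case: eqP.
  - move=> _ [a ->]; exists (fun i => if i == n then 0 else a i).
    rewrite big_nat_recr //= g'E eqxx scale0r addr0.
    by apply: eq_big_nat => i /andP[_ ilt]; rewrite ltn_eqF.
  - exists (fun i => (i == n)%:R); rewrite big_nat_recr //= g'E.
    rewrite big_nat_cond big1 ?add0r /g' ?eqxx ?scale1r // => i.
    by move=> /andP[/andP[_ ilt] _]; rewrite ltn_eqF // scale0r.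
by case=> a ->; exists (fun i => a i); rewrite big_mkord.
Qed.

End Modules.

Definition noetherian (R : comPzRingType) : Prop := macc [set: R^o].

Lemma is_idealP (R : comPzRingType) (I : set R) :
  is_ideal I <-> submod (I : set R^o).
Proof. by split=> [[? ? ?]|/submodP [? ? ?]]; [apply/submodP|]. Qed.

Section Noetherian.
Variable R : comPzRingType.

Lemma noetherian_fg (I : set R) : noetherian R -> is_ideal I ->
  exists n (y : 'I_n -> R), (forall i, I (y i)) /\
    forall x, I x -> exists a : 'I_n -> R, x = \sum_i a i * y i.
Proof. by move=> hR /is_idealP hI; apply: (macc_fg hR hI). Qed.

Lemma fg_noetherian :
  (forall I : set R, is_ideal I -> exists (T : finType) (y : T -> R),
     (forall i, I (y i)) /\
     forall x, I x -> exists a : T -> R, x = \sum_i a i * y i) ->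
  noetherian R.
Proof.
move=> hfg J hJ sJ _.
have hI : is_ideal (\bigcup_n J n).
  apply/is_idealP/submodP; split.
  - by exists 0%N => //; case: (hJ 0%N).
  - move=> x y [m _ Jx] [n _ Jy]; exists (maxn m n) => //.
    apply: (opsubD (hJ _)).
    + exact: (chain_le sJ (leq_maxl m n) Jx).
    + exact: (chain_le sJ (leq_maxr m n) Jy).
  - by move=> a x [m _ Jx]; exists m => //; apply: (submodZ _ (hJ m)).
have [T [y [Iy hy]]] := hfg _ hI.
have /choice [f hf] : forall i, exists k, J k (y i).
  by move=> i; case: (Iy i) => k _; exists k.
exists (\max_i f i) => m x Jx; have [|a ->] := hy x; first by exists m.
apply: (submod_comb _ _ (hJ _)) => i.
exact: (chain_le sJ (leq_bigmax i) (hf i)).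
Qed.

(** By induction on the number of generators: a chain of submodules is constant
    as soon as its intersections with the span of the other generators and the
    ideals of coefficients of the last generator are. *)
Lemma fg_macc (V : lmodType R) (B : set V) (I : finType) (g : I -> V) :
  noetherian R -> (forall m, B m -> exists a : I -> R, m = \sum_i a i *: g i) ->
  macc B.
Proof.
move=> hR hB.
pose span (r : seq I) : set V :=
  [set m | exists a : I -> R, m = \sum_(i <- r) a i *: g i].
suff hr r : macc (span r) by apply: acc_sub (hr (index_enum I)) => m /hB.
have span_sub r' : submod (span r').
  apply/submodP; split.
  - by exists (fun=> 0); rewrite big1 // => i _; rewrite scale0r.
  - move=> _ _ [a ->] [b ->]; exists (fun i => a i + b i).
    by rewrite -big_split; apply: eq_bigr => i _; rewrite scalerDl.
  - move=> c _ [a ->]; exists (fun i => c * a i).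
    by rewrite scaler_sumr; apply: eq_bigr => i _; rewrite scalerA.
elim: r => [|v r IH] J hJ sJ JB.
  exists 0%N => m x /JB [a]; rewrite big_nil => ->.
  by case: (hJ 0%N).
pose c n : set R^o := [set a | exists2 x, span r x & J n (a *: g v + x)].
have hc n : submod (c n).
  apply/submodP; have /submodP [s0 sD sZ] := span_sub r; split.
  - exists 0 => //; rewrite scale0r addr0; by case: (hJ n).
  - move=> a b [x sx Jx] [y sy Jy]; exists (x + y); first exact: sD.
    by rewrite scalerDl addrACA; apply: (opsubD (hJ n)).
  - move=> a b [x sx Jx]; exists (a *: x); first exact: sZ.
    by rewrite -scalerA -scalerDr; apply: (submodZ _ (hJ n)).
have [||n1 hn1] := hR c hc.
- by move=> n a [x sx /sJ]; exists x.
- by [].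
have [|||n2 hn2] := IH (fun n => J n `&` span r).
- by move=> n; apply: (opsubI (hJ n) (span_sub r)).
- by move=> n x [/sJ Jx sx].
- by move=> n x [].
exists (maxn n1 n2) => m x Jx.
have [a] := JB m x Jx; rewrite big_cons; set y := \sum_(_ <- _) _ => xE.
have sy : span r y by exists a.
have [|z sz Jz] := hn1 (maxn m n1) (a v).
  exists y => //; rewrite -xE; exact: (chain_le sJ (leq_maxl m n1) Jx).
have {}Jz := chain_le sJ (leq_maxl n1 n2) Jz.
have -> : x = (a v *: g v + z) + (y - z).
  by rewrite xE -addrA (addrC z) subrK.
apply: (opsubD (hJ _) Jz).
suff [] : (J n2 `&` span r) (y - z).
  by move=> Jyz _; apply: chain_le Jyz => //; apply: leq_maxr.
apply: (hn2 (maxn m (maxn n1 n2))); split; last first.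
  by case: (span_sub r) => _ hsB _; apply: hsB.
have -> : y - z = x - (a v *: g v + z) by rewrite xE opprD addrACA subrr add0r.
case: (hJ (maxn m (maxn n1 n2))) => _ hJB _; apply: hJB.
- exact: (chain_le sJ (leq_maxl _ _) Jx).
- exact: (chain_le sJ (leq_maxr _ _) Jz).
Qed.

Lemma ideal_max (F : set (set R)) : noetherian R ->
  (forall I, F I -> is_ideal I) -> (exists I, F I) ->
  exists2 I, F I & forall I', F I' -> I `<=` I' -> I' `<=` I.
Proof.
move=> hR hF exF; apply: (acc_max hR) => // I /hF hI.
by split=> //; apply/is_idealP.
Qed.

Lemma ideal_add (I : set R) a : is_ideal I ->
  let I' := [set x | exists2 y, I y & exists c, x = y + c * a] in
  [/\ is_ideal I', I `<=` I' & I' a].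
Proof.
move=> [I0 ID IM] /=; split.
- split.
  + by exists 0 => //; exists 0; rewrite mul0r addr0.
  + move=> _ _ [y Iy [c ->]] [z Iz [d ->]]; exists (y + z); first exact: ID.
    by exists (c + d); ring.
  + move=> b _ [y Iy [c ->]]; exists (b * y); first exact: IM.
    by exists (b * c); ring.
- by move=> y Iy; exists y => //; exists 0; rewrite mul0r addr0.
- by exists 0 => //; exists 1; rewrite mul1r add0r.
Qed.

(** An ideal maximal outside a family of ideals that is closed under enlargement
    and products is prime. Besides powers of one element, this is applied to the
    ideals that contain some power of a given ideal. *)
Lemma exists_prime (F : set (set R)) (I : set R) : noetherian R ->
  is_ideal I -> ~ F I -> F setT ->
  (forall I J, is_ideal I -> is_ideal J -> F I -> I `<=` J -> F J) ->
  (forall I J K, is_ideal I -> is_ideal J -> is_ideal K -> F I -> F J ->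
     (forall a b, I a -> J b -> K (a * b)) -> F K) ->
  exists P : Spec R, I `<=` P /\ ~ F P.
Proof.
move=> hR hI nFI FT Fup Fmul.
have [||P [hP nFP sP] hmax] :=
  @ideal_max [set J | [/\ is_ideal J, ~ F J & I `<=` J]] hR.
- by move=> J [].
- by exists I; split.
have PE (J : set R) : is_ideal J -> P `<=` J -> ~ F J -> J `<=` P.
  by move=> hJ sPJ nFJ; apply: hmax => //; split=> //; apply: subset_trans sPJ.
have [P0 PD PM] := hP.
have nP1 : ~ P 1.
  move=> P1; apply: nFP; suff -> : P = setT by [].
  by apply/seteqP; split=> // x _; rewrite -(mulr1 x); apply: PM.
have prime_P a b : P (a * b) -> P a \/ P b.
  move=> Pab; apply: contrapT => /not_orP [nPa nPb]; apply: nFP.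
  have [hIa sPa Ia] := ideal_add a hP; have [hIb sPb Ib] := ideal_add b hP.
  apply: (Fmul _ _ _ hIa hIb hP).
  - by apply: contrapT => nF; apply: nPa; apply: PE nF _ _.
  - by apply: contrapT => nF; apply: nPb; apply: PE nF _ _.
  - move=> _ _ [y Py [c ->]] [z Pz [d ->]].
    have -> : (y + c * a) * (z + d * b) =
      (z + d * b) * y + (c * a * z + (c * d) * (a * b)) by ring.
    by apply: (PD); [apply: (PM) | apply: (PD); apply: (PM)].
by exists (MkSpec hP nP1 prime_P).
Qed.

End Noetherian.

(** * Rings finite over their p-th powers *)

Definition ffinite (q : nat) (A : comPzRingType) : Prop :=
  exists (T : finType) (x : T -> A),
    forall a, exists c : T -> A, a = \sum_t c t ^+ q * x t.

(** ** Algebras of finite type *)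

Section FiniteType.
Variables (k : fieldType) (A : comPzRingType) (f : {rmorphism k -> A}).

Definition kscal : set (A -> A) := range (fun c : k => *%R (f c)).

Lemma acc_line : acc kscal (range f).
Proof.
move=> J hJ sJ JB.
have [[n [x Jx x0]]|h] := pselect (exists n, exists2 x, J n x & x <> 0).
  exists n => m y /JB [c _ <-]; case: (JB n x Jx) => d _ dx; subst x.
  have d0 : d != 0 by apply/eqP => d0; apply: x0; rewrite d0 rmorph0.
  have -> : f c = f (c / d) * f d by rewrite -rmorphM divfK.
  by case: (hJ n) => _ _ hW; apply: (hW (fun x => _ * x)) => //; exists (c / d).
exists 0%N => m x Jx; suff -> : x = 0 by case: (hJ 0%N).
by apply: contrapT => x0; apply: h; exists m, x.
Qed.

(** The subring generated by [k] and [s] grows by one generator at a time. The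
    operators are multiplications, so that ideals are stable under them. *)
Lemma acc_adjoin (s : seq A) : exists (Om : set (A -> A)) (B : set A),
  [/\ acc Om B, opsub Om B,
      (forall w, Om w -> exists a, w = *%R a),
      (B 1 /\ forall x y, B x -> B y -> B (x * y))
    & (forall c, B (f c)) /\ {in s, forall y, B y}].
Proof.
elim: s => [|y s [Om [B [aB sB hW [B1 BM] [Bf Bs]]]]].
  exists kscal, (range f); split=> //.
  - exact: acc_line.
  - split; first by exists 0; rewrite ?rmorph0.
    + by move=> _ _ [c _ <-] [d _ <-]; exists (c - d); rewrite ?rmorphB.
    + by move=> _ _ [c _ <-] [d _ <-]; exists (c * d); rewrite ?rmorphM.
  - by move=> _ [c _ <-]; exists (f c).
  - split; first by exists 1; rewrite ?rmorph1.
    by move=> _ _ [c _ <-] [d _ <-]; exists (c * d); rewrite ?rmorphM.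
pose m : {additive A -> A} := GRing.mull_fun y idfun.
pose P := poly_all B m.
have comm w x : Om w -> w (m x) = m (w x).
  by move=> /hW [a ->]; rewrite /= mulrCA.
have addw w x z : Om w -> w (x + z) = w x + w z.
  by move=> /hW [a ->]; rewrite mulrDr.
have sP := poly_all_opsub sB comm addw.
have BP : B `<=` P by apply: sub_poly_all sB.
have PM x z : P x -> P z -> P (x * z).
  have PB b : B b -> P z -> P (b * z).
    move=> Bb [d [c hc ->]]; exists d; exists (fun i => b * c i) => [i|].
      exact: BM.
    rewrite mulr_sumr; apply: eq_bigr => i _.
    by move: (c i) => v; elim: i => //= i <-; rewrite mulrCA.
  move=> [d [c hc ->]] Pz; rewrite mulr_suml; apply: (opsub_sum _ sP) => i _.
  move: (c i) (hc i) => v Bv; elim: i => [|i IH] /=; first exact: PB.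
  by rewrite -mulrA; case: sP => _ _ h; apply: (h m) => //; right.
exists (Om `|` [set (m : A -> A)]), P; split=> //.
- exact: hilbert_basis.
- by move=> w [/hW //|->]; exists y.
- by split=> //; apply: BP.
- split=> [c|z]; first exact: BP.
  rewrite inE => /orP[/eqP->|/Bs]; last by move/BP.
  rewrite -(mulr1 y); case: sP => _ _ h; apply: (h m); first by right.
  exact: BP.
Qed.

Hypothesis fT : is_finite_type f.

Lemma finite_type_noetherian : noetherian A.
Proof.
have [s hs] := fT; have [Om [B [aB sB hW [B1 BM] [Bf Bs]]]] := acc_adjoin s.
have BT a : B a.
  have [B0 BB _] := sB.
  pose S := [pred a | `[< B a >]].
  have SP x : reflect (B x) (x \in S) by apply: asboolP.
  apply/SP/hs => [|c|y /Bs By]; [|exact/SP|exact/SP].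
  split; first exact/SP.
  - by move=> x y /SP Bx /SP By; apply/SP/BB.
  - by move=> x y /SP Bx /SP By; apply/SP/BM.
move=> J hJ sJ _; apply: (aB J) => // n; last by move=> x _.
case: (hJ n) => J0 JB JW; split=> // w x /hW [a ->] Jx.
by apply: (JW (fun y => a * y)) => //; exists a.
Qed.

Variable p : nat.
Hypotheses (p_prime : prime p) (pA : p%:R = 0 :> A) (hk : perfect_field p k).

(** The family [x] consists of the monomials in [s] with exponents less than
    [p]. *)
Lemma ffinite_adjoin (s : seq A) : exists (T : finType) (x : T -> A),
  let S : set A := [set a | exists c : T -> A, a = \sum_t c t ^+ p * x t] in
  S 1 /\ {in s, forall y a, S a -> S (y * a)}.
Proof.
elim: s => [|y s [T [x [S1 Ss]]]].
  exists unit, (fun=> 1); split=> //; exists (fun=> 1).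
  by rewrite big_const cardT enumT unlock /= expr1n mulr1 addr0.
have [p' pE] : exists p', p = p'.+1 by exists p.-1; rewrite prednK ?prime_gt0.
exists ('I_p * T)%type, (fun t : 'I_p * T => y ^+ t.1 * x t.2).
have SE (c : 'I_p * T -> A) : \sum_t c t ^+ p * (y ^+ t.1 * x t.2) =
    \sum_(i < p) y ^+ i * \sum_t c (i, t) ^+ p * x t.
  under [RHS]eq_bigr do rewrite mulr_sumr.
  by rewrite pair_bigA; apply: eq_bigr => -[i t] _ /=; rewrite mulrCA.
split.
  have [c cE] := S1; exists (fun t : 'I__ * T => if t.1 == 0%N :> nat then c t.2 else 0).
  rewrite SE; subst p; rewrite big_ord_recl /= mul1r -cE big1 ?addr0 // => i _.
  by rewrite big1 ?mulr0 // => t _; rewrite expr0n /= mul0r.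
move=> z; rewrite inE => /orP[/eqP-> {z}|zs] a [c ->]; rewrite SE mulr_sumr.
  (* Multiplication by [y] shifts the exponents, and the top one wraps around
     as the p-th power of [y]. *)
  move: c SE; rewrite {}pE => c SE.
  exists (fun t : 'I__ * T => if t.1 == 0%N :> nat then y * c (ord_max, t.2)
                   else c (inord t.1.-1, t.2)).
  rewrite SE big_ord_recr big_ord_recl /= addrC; congr (_ + _).
    rewrite mul1r mulrA -exprS mulr_sumr; apply: eq_bigr => t _.
    by rewrite exprMn_comm ?mulrA //; apply: mulrC.
  apply: eq_bigr => i _; rewrite mulrA -exprS; congr (_ * _).
  apply: eq_bigr => t _ /=; congr (c (_, _) ^+ _ * _).
  by apply: val_inj; rewrite /= inordK ?add0n // ltnS ltnW.
have /choice [d hd] : forall i, exists d : T -> A,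
    z * (\sum_t c (i, t) ^+ p * x t) = \sum_t d t ^+ p * x t.
  by move=> i; apply: (Ss z zs); exists (fun t => c (i, t)).
exists (fun t : 'I_p * T => d t.1 t.2); rewrite SE; apply: eq_bigr => i _.
by rewrite mulrCA hd.
Qed.

(** The multipliers of the span of these monomials form a subring that contains
    [k], which consists of p-th powers, and the generators. *)
Lemma finite_type_ffinite : ffinite p A.
Proof.
have [s hs] := fT; have [T [x]] := ffinite_adjoin s.
set S : set A := [set _ | _] => -[S1 Ss].
have hD a b : (a - b) ^+ p = a ^+ p - b ^+ p :> A.
  by apply/eqP; rewrite eq_sym subr_eq -exprDp // subrK.
have SB a b : S a -> S b -> S (a - b).
  move=> [c ->] [d ->]; exists (fun t => c t - d t).
  by rewrite -sumrB; apply: eq_bigr => t _; rewrite hD mulrBl.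
pose U := [pred a | `[< forall b, S b -> S (a * b) >]].
have UP a : reflect (forall b, S b -> S (a * b)) (a \in U) by apply: asboolP.
exists T, x => a; suff /UP/(_ 1 S1) : a \in U by rewrite mulr1.
apply: hs => [|c|y ys].
- split; first by apply/UP => b; rewrite mul1r.
  + by move=> u v /UP hu /UP hv; apply/UP => b Sb; rewrite mulrBl; apply: SB; auto.
  + by move=> u v /UP hu /UP hv; apply/UP => b Sb; rewrite -mulrA; auto.
- apply/UP => _ [d ->]; have [c' <-] := hk c; exists (fun t => f c' * d t).
  rewrite rmorphXn mulr_sumr; apply: eq_bigr => t _.
  by rewrite mulrA exprMn_comm //; apply: mulrC.
- by apply/UP => b; apply: Ss.
Qed.

End FiniteType.

(** ** Localizations *)

Section Localization.
Variables (A B : comPzRingType) (S : set A) (g : {rmorphism A -> B}).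
Hypothesis (hS : mult_closed S) (hg : is_localization S g).

Lemma localization_noetherian : noetherian A -> noetherian B.
Proof.
case: hg => unitS frac _ hA J hJ sJ _.
have [||//|n hn] := hA (fun n => [set a | J n (g a)] : set A^o).
- move=> n; apply/submodP; have /submodP [J0 JD JZ] := hJ n; split.
  + by rewrite /= rmorph0.
  + by move=> x y /= Jx Jy; rewrite rmorphD; apply: JD.
  + by move=> a x /= Jx; rewrite rmorphM; apply: JZ.
- by move=> n x /sJ.
exists n => m b Jb; have [a [s [Ss bs]]] := frac b; have [c cs] := unitS s Ss.
have -> : b = c * g a by rewrite -bs mulrCA cs mulr1.
apply: (submodZ (V := B^o) _ (hJ n)); apply: (hn m); rewrite /= -bs mulrC.
exact: (submodZ (V := B^o) _ (hJ m)).
Qed.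

(* [b = a / s] is rewritten as [a s^(q-1) / s^q]. *)
Lemma localization_ffinite q : (0 < q)%N -> ffinite q A -> ffinite q B.
Proof.
case: hg => unitS frac _ q0 [T [x hx]].
exists T, (g \o x) => b.
have [a [s [Ss bs]]] := frac b; have [c cs] := unitS s Ss.
have [d dE] := hx (a * s ^+ q.-1); exists (fun t => c * g (d t)).
have -> : b = c ^+ q * g (a * s ^+ q.-1).
  rewrite rmorphM rmorphXn -bs -mulrA -exprS prednK // mulrCA -exprMn_comm.
    by rewrite cs expr1n mulr1.
  exact: mulrC.
rewrite dE rmorph_sum mulr_sumr; apply: eq_bigr => t _ /=.
rewrite rmorphM rmorphXn mulrA -exprMn_comm //; exact: mulrC.
Qed.

End Localization.

(** ** Powers of an ideal *)

Section IdealPow.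
Variables (A : comPzRingType) (I : set A).
Local Notation "I ^^ n" := (ideal_pow I n) (at level 30).

Lemma ideal_pow_ideal n : is_ideal (I ^^ n).
Proof.
split.
- exists 0%N, (fun=> 0), (fun _ _ => 0); split; first by case.
  by rewrite big_ord0.
- move=> _ _ [m [c [y [Iy ->]]]] [m' [c' [y' [Iy' ->]]]].
  exists (m + m')%N.
  exists (fun j => match fintype.split j with inl j => c j | inr j => c' j end).
  exists (fun j => match fintype.split j with inl j => y j | inr j => y' j end).
  split=> [j t|]; first by case: (fintype.split j).
  by rewrite big_split_ord; congr (_ + _); apply: eq_bigr => j _;
    rewrite (unsplitK (inl j)) || rewrite (unsplitK (inr j)).
- move=> a _ [m [c [y [Iy ->]]]]; exists m, (fun j => a * c j), y; split=> //.
  by rewrite mulr_sumr; apply: eq_bigr => j _; rewrite mulrA.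
Qed.

Lemma ideal_pow0 x : (I ^^ 0) x.
Proof.
exists 1%N, (fun=> x), (fun _ _ => 0); split=> [j []//|].
by rewrite big_ord1 big_ord0 mulr1.
Qed.

Lemma ideal_powS n x y : I x -> (I ^^ n) y -> (I ^^ n.+1) (x * y).
Proof.
move=> Ix [m [c [z [Iz ->]]]].
exists m, c, (fun j t => if unlift ord0 t is Some t' then z j t' else x).
split=> [j t|]; first by case: unliftP.
rewrite mulr_sumr; apply: eq_bigr => j _.
rewrite big_ord_recl unlift_none mulrCA; congr (_ * (_ * _)).
by apply: eq_bigr => t _; rewrite liftK.
Qed.

Lemma ideal_pow_ind n (K : set A) : K 0 ->
  (forall x y, K x -> K y -> K (x + y)) ->
  (forall x y, I x -> (I ^^ n) y -> K (x * y)) -> I ^^ n.+1 `<=` K.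
Proof.
move=> K0 KD KM _ [m [c [z [Iz ->]]]]; apply: (big_ind K) => // j _.
rewrite big_ord_recl mulrCA; apply: KM => //.
exists 1%N, (fun=> c j), (fun _ t => z j (lift ord0 t)); split=> [//|].
by rewrite big_ord1.
Qed.

Lemma ideal_pow_succ n : I ^^ n.+1 `<=` I ^^ n.
Proof.
case: (ideal_pow_ideal n) => I0 ID IM.
by apply: ideal_pow_ind => // x y _; apply: IM.
Qed.

Lemma ideal_pow_le m n : (m <= n)%N -> I ^^ n `<=` I ^^ m.
Proof.
move=> /subnK <-; elim: (n - m)%N => [|k IH] //.
by apply: subset_trans IH; apply: ideal_pow_succ.
Qed.

Lemma ideal_powD m n x y : (I ^^ m) x -> (I ^^ n) y -> (I ^^ (m + n)) (x * y).
Proof.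
move=> + Iy; elim: m x => [|m IH] x.
  by move=> _; case: (ideal_pow_ideal n) => _ _; apply.
case: (ideal_pow_ideal (m.+1 + n)) => I0 ID IM.
apply: (@ideal_pow_ind m [set x | (I ^^ (m.+1 + n)) (x * y)]).
- by rewrite /= mul0r.
- by move=> u v /= hu hv; rewrite mulrDl; apply: ID.
- by move=> u v Iu Iv /=; rewrite -mulrA addSn; apply: ideal_powS; auto.
Qed.

Lemma ideal_pow_split m n (K : set A) : is_ideal K ->
  (forall x y, (I ^^ m) x -> (I ^^ n) y -> K (x * y)) -> I ^^ (m + n) `<=` K.
Proof.
elim: m K => [|m IH] K hK hKM.
  by move=> y Iy; rewrite -(mul1r y); apply: hKM => //; apply: ideal_pow0.
case: (hK) => K0 KD KM; rewrite addSn; apply: ideal_pow_ind => // u v Iu Iv.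
apply: (IH [set v | K (u * v)]) => //; first split.
- by rewrite /= mulr0.
- by move=> a b /= ha hb; rewrite mulrDr; apply: KD.
- by move=> a b /= hb; rewrite mulrCA; apply: KM.
- by move=> x y Ix Iy /=; rewrite mulrA; apply: hKM => //; apply: ideal_powS.
Qed.

End IdealPow.

Section IdealFacts.
Variables (A : comPzRingType) (K : set A).
Hypothesis hK : is_ideal K.

Lemma idealD x y : K x -> K y -> K (x + y).
Proof. by case: hK => _ h _; apply: h. Qed.
Lemma idealM a x : K x -> K (a * x).
Proof. by case: hK => _ _; apply. Qed.
Lemma ideal_mulr a x : K x -> K (x * a).
Proof. by rewrite mulrC; apply: idealM. Qed.
Lemma idealN x : K x -> K (- x).
Proof. by rewrite -mulN1r; apply: idealM. Qed.
Lemma idealB x y : K x -> K y -> K (x - y).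
Proof. by move=> hx hy; apply: idealD => //; apply: idealN. Qed.
Lemma ideal_sum (T : Type) (r : seq T) (F : T -> A) :
  (forall t, K (F t)) -> K (\sum_(t <- r) F t).
Proof.
case: hK => K0 KD _ hF; exact: (big_ind K).
Qed.
Lemma cong_refl x : K (x - x).
Proof. by rewrite subrr; case: hK. Qed.
Lemma cong_sym x y : K (x - y) -> K (y - x).
Proof. by move=> h; rewrite -opprB; apply: idealN. Qed.
Lemma cong_trans y x z : K (x - y) -> K (y - z) -> K (x - z).
Proof. by move=> h h'; rewrite -(subrKA y); apply: idealD. Qed.
Lemma congD x y x' y' : K (x - y) -> K (x' - y') -> K (x + x' - (y + y')).
Proof. by move=> h h'; rewrite opprD addrACA; apply: idealD. Qed.
Lemma congM x y x' y' : K (x - y) -> K (x' - y') -> K (x * x' - y * y').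
Proof.
move=> h h'; have -> : x * x' - y * y' = x' * (x - y) + y * (x' - y') by ring.
by apply: idealD; apply: idealM.
Qed.
Lemma cong_sum (T : Type) (r : seq T) (F G : T -> A) :
  (forall t, K (F t - G t)) -> K (\sum_(t <- r) F t - \sum_(t <- r) G t).
Proof. by move=> h; rewrite -sumrB; apply: ideal_sum. Qed.
Lemma cong_mem x y : K (x - y) -> K y -> K x.
Proof. by move=> h hy; rewrite -(subrK y x); apply: idealD. Qed.
End IdealFacts.

(** ** The Artin-Rees property *)

(** The Rees module of [A] with respect to an ideal is realized inside
    sequences: [x t^n] is the sequence with [x] in position [n], and [y t]
    acts as a shift followed by multiplication by [y]. *)
Section Rees.
Variable A : comPzRingType.
Local Notation V := (nat -> A).

Definition seq_shift (y : A) (f : V) : V :=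
  fun n => if n is n'.+1 then y * f n' else 0.

Lemma seq_shift_additive y : zmod_morphism (seq_shift y).
Proof.
move=> f h; apply/funext => -[|n] /=; first by rewrite !fctE /= subrr.
by rewrite !fctE /= mulrBr.
Qed.
HB.instance Definition _ y :=
  GRing.isZmodMorphism.Build V V (seq_shift y) (seq_shift_additive y).

Definition seq_scale (a : A) (f : V) : V := fun n => a * f n.

Definition seq_single (n : nat) (a : A) : V := fun i => if i == n then a else 0.

Lemma rees_acc (r : seq A) : noetherian A ->
  exists (Om : set (V -> V)) (B : set V),
  [/\ acc Om B, opsub Om B, (forall a, B (seq_single 0 a)),
     (forall a, Om (seq_scale a)) /\ {in r, forall y, Om (seq_shift y)}
   & forall w, Om w -> (exists a, w = seq_scale a) \/
       (exists2 y, y \in r & w = seq_shift y)].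
Proof.
move=> hA; elim: r => [|y r [Om [B [aB sB B0 [Oa Or] hO]]]].
  exists (range seq_scale), [set f | forall n, f n.+1 = 0].
  have sclE a f : seq_scale a f = (fun n => a * f n) by [].
  split=> //.
  - move=> J hJ sJ JB.
    have fE n f : J n f -> f = seq_single 0 (f 0%N).
      by move=> /JB fS; apply/funext => -[|i].
    have [||//|n hn] := hA (fun n => [set a | J n (seq_single 0 a)] : set A^o).
    + move=> n; case: (hJ n) => J0 JB' JW; split.
      * rewrite /mkset; have -> : seq_single 0 0 = 0 :> V by apply/funext; case.
        exact: J0.
      * rewrite /mkset => x z Jx Jz.
        have -> : seq_single 0 (x - z) = seq_single 0 x - seq_single 0 z :> V.
          by apply/funext => -[|i]; rewrite !fctE /= ?subrr.
        exact: JB'.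
      * rewrite /mkset => _ x [a _ <-] Jx.
        have -> : seq_single 0 (a * x) = seq_scale a (seq_single 0 x).
          by apply/funext => -[|i]; rewrite /seq_scale /= ?mulr0.
        by apply: JW => //; exists a.
    + by move=> n x /sJ.
    exists n => m f Jf; rewrite (fE m f Jf); apply: (hn m) => /=.
    by rewrite -(fE m f Jf).
  - split=> //.
    + by move=> f h hf hh n; rewrite !fctE /= hf hh subrr.
    + by move=> _ f [a _ <-] hf n; rewrite /seq_scale hf mulr0.
  - by move=> _ [a _ <-]; left; exists a.
have comm w f : Om w -> w (seq_shift y f) = seq_shift y (w f).
  move=> /hO [[a ->]|[z _ ->]]; apply/funext => -[|n] //=;
    rewrite /seq_scale /= ?mulr0 //; last by case: n => [|n] /=; rewrite ?mulr0 // mulrCA.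
  by rewrite mulrCA.
have addw w f h : Om w -> w (f + h) = w f + w h.
  move=> /hO [[a ->]|[z _ ->]]; apply/funext => -[|n];
    by rewrite !fctE /seq_scale /= ?mulrDr ?addr0.
pose P := poly_all B (seq_shift y).
have BP : B `<=` P by apply: sub_poly_all sB.
exists (Om `|` [set seq_shift y]), P; split.
- exact: hilbert_basis.
- exact: poly_all_opsub.
- by move=> a; apply: BP.
- split=> [a|z]; first by left.
  by rewrite inE => /orP[/eqP->|/Or]; [right|left].
- move=> w [/hO [[a ->]|[z zr ->]]|->]; first by left; exists a.
  + by right; exists z => //; rewrite inE zr orbT.
  + by right; exists y => //; rewrite inE eqxx.
Qed.

End Rees.

Definition ideal_prod (A : comPzRingType) (K L : set A) : set A :=
  [set x | exists (r : nat) (c a : 'I_r -> A),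
     [/\ (forall j, K (c j)), (forall j, L (a j)) & x = \sum_j c j * a j]].

Section IdealProd.
Variables (A : comPzRingType) (K L : set A).
Hypothesis hK : is_ideal K.

Lemma ideal_prod_ideal : is_ideal (ideal_prod K L).
Proof.
split.
- exists 0%N, (fun=> 0), (fun=> 0); split; [by case|by case|].
  by rewrite big_ord0.
- move=> _ _ [m [c [y [Kc Ly ->]]]] [m' [c' [y' [Kc' Ly' ->]]]].
  exists (m + m')%N.
  exists (fun j => match fintype.split j with inl j => c j | inr j => c' j end).
  exists (fun j => match fintype.split j with inl j => y j | inr j => y' j end).
  split=> [j|j|]; [by case: (fintype.split j)|by case: (fintype.split j)|].
  by rewrite big_split_ord; congr (_ + _); apply: eq_bigr => j _;
    rewrite (unsplitK (inl j)) || rewrite (unsplitK (inr j)).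
- move=> a _ [m [c [y [Kc Ly ->]]]]; exists m, (fun j => a * c j), y.
  split=> // [j|]; first exact: idealM.
  by rewrite mulr_sumr; apply: eq_bigr => j _; rewrite mulrA.
Qed.

Lemma ideal_prod_mem c a : K c -> L a -> ideal_prod K L (c * a).
Proof.
by move=> Kc La; exists 1%N, (fun=> c), (fun=> a); rewrite big_ord1.
Qed.

End IdealProd.

(** The filtrations generated by [L] in degrees at most [m] form, as [m] varies,
    an increasing chain in the Rees module, which is noetherian. *)
Lemma artin_rees (A : comPzRingType) (I : set A) (L : nat -> set A) :
  noetherian A -> is_ideal I -> (forall n, is_ideal (L n)) ->
  (forall n, L n `<=` ideal_pow I n) ->
  (forall n y a, I y -> L n a -> L n.+1 (y * a)) ->
  exists m, forall n, (m < n)%N -> L n `<=` ideal_prod (ideal_pow I (n - m)) (L m).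
Proof.
move=> hA hI hL LI LS.
have [r [y [Iy yI]]] := noetherian_fg hA hI.
have [Om [B [aB sB B0 [Oa Oy] hO]]] := rees_acc (codom y) hA.
have Os i : Om (seq_shift (y i)) by apply: Oy; apply: codom_f.
have Bsingle n a : ideal_pow I n a -> B (seq_single n a).
  elim: n a => [|n IH] a; first by move=> _; apply: B0.
  apply: (@ideal_pow_ind _ I n [set a | B (seq_single n.+1 a)]).
  - rewrite /mkset; have -> : seq_single n.+1 0 = 0 :> (nat -> A).
      by apply/funext => i; rewrite /seq_single; case: eqP.
    by case: sB.
  - move=> u v /= Bu Bv.
    have -> : seq_single n.+1 (u + v) = seq_single n.+1 u + seq_single n.+1 v
        :> (nat -> A).
      by apply/funext => i; rewrite fctE /seq_single; case: eqP; rewrite ?addr0.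
    exact: (opsubD sB).
  - move=> _ v /yI [c ->] Iv /=.
    have -> : seq_single n.+1 ((\sum_i c i * y i) * v) =
        \sum_i seq_scale (c i) (seq_shift (y i) (seq_single n v)) :> (nat -> A).
      apply/funext => j; rewrite fct_sumE /seq_single /seq_scale /seq_shift.
      case: j => [|j] /=; first by rewrite big1 // => i _; rewrite mulr0.
      rewrite eqSS; case: eqP => _.
        by rewrite mulr_suml; apply: eq_bigr => i _; rewrite mulrA.
      by rewrite big1 // => i _; rewrite !mulr0.
    apply: (opsub_sum _ sB) => i _; case: sB => _ _ BW.
    by apply: (BW (seq_scale _)) => //; apply: (BW (seq_shift _)) => //; apply: IH.
pose P m n := if (n <= m)%N then L n else ideal_prod (ideal_pow I (n - m)) (L m).
have hP m n : is_ideal (P m n).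
  by rewrite /P; case: ifP => // _; apply: ideal_prod_ideal; apply: ideal_pow_ideal.
have PS m n u v : I u -> P m n v -> P m n.+1 (u * v).
  rewrite /P => Iu; have [mn|nm] := leqP n m.
    move: mn; rewrite leq_eqVlt => /orP[/eqP->|nm]; last by rewrite nm; apply: LS.
    rewrite ltnn subSnn => Lv; apply: ideal_prod_mem => //.
    by rewrite -(mulr1 u); apply: ideal_powS => //; apply: ideal_pow0.
  rewrite leqNgt (ltnW nm : (m < n.+1)%N) /= => -[s [c [a [Ic La ->]]]].
  exists s, (fun j => u * c j), a; split=> // [j|].
    by rewrite subSn ?(ltnW nm) //; apply: ideal_powS.
  by rewrite mulr_sumr; apply: eq_bigr => j _; rewrite mulrA.
have Pm m n : P m n `<=` P m.+1 n.
  move=> v; rewrite /P; have [nm|mn] := leqP n m; first by rewrite (leqW nm).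
  have hQ : is_ideal (if (n <= m.+1)%N then L n
      else ideal_prod (ideal_pow I (n - m.+1)) (L m.+1)) := hP m.+1 n.
  move=> [s [c [a [Ic La ->]]]]; apply: (ideal_sum hQ) => j.
  move: (c j) (a j) (Ic j) (La j) => u w Iu Lw {j s c a Ic La}.
  move: Iu; have -> : (n - m = (n - m.+1).+1)%N by rewrite subnSK.
  apply: (@ideal_pow_ind _ I (n - m.+1) [set u | P m.+1 n (u * w)]).
  - by rewrite /= mul0r; case: (hP m.+1 n).
  - by move=> a b /= ha hb; rewrite mulrDl; apply: idealD.
  - move=> a b Ia Ib /=; rewrite (mulrC a) -mulrA /P.
    have [nm|mn'] := leqP n m.+1.
      have -> : n = m.+1 by apply/eqP; rewrite eqn_leq nm.
      by apply: (idealM (hL _)); apply: LS.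
    by apply: ideal_prod_mem => //; apply: LS.
have [|||m hm] := aB (fun m => B `&` [set f | forall n, P m n (f n)]).
- move=> m; apply: (opsubI sB); split.
  + by move=> n; case: (hP m n).
  + by move=> f h hf hh n; rewrite fctE; apply: idealB.
  + move=> w f /hO [[a ->]|[_ /codomP [i ->] ->]] hf n.
      by rewrite /seq_scale; apply: idealM.
    case: n => [|n] /=; first by case: (hP m 0%N).
    exact: PS.
- by move=> m f [Bf hf]; split=> // n; apply: Pm.
- by move=> m f [].
exists m => n mn a La.
have [|_ /(_ n)] := hm n (seq_single n a).
  split; first by apply: Bsingle; apply: LI.
  move=> i; rewrite /seq_single; case: eqP => [->|_]; last by case: (hP n i).
  by rewrite /P leqnn.
by rewrite /seq_single eqxx /P leqNgt mn.
Qed.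

(** ** Completions *)

Section Completion.
Variables (A B : comPzRingType) (I : set A) (g : {rmorphism A -> B}).
Hypothesis hI : is_ideal I.
Variable pi : B -> nat -> A.
Local Notation eqI n a b := (ideal_pow I n (a - b)).
Hypothesis pi_succ : forall b n, eqI n (pi b n.+1) (pi b n).
Hypothesis pi_g : forall a n, eqI n (pi (g a) n) a.
Hypothesis pi_D : forall b c n, eqI n (pi (b + c) n) (pi b n + pi c n).
Hypothesis pi_M : forall b c n, eqI n (pi (b * c) n) (pi b n * pi c n).
Hypothesis pi_lim : forall a : nat -> A, (forall n, eqI n (a n.+1) (a n)) ->
  exists! b, forall n, eqI n (pi b n) (a n).

Let In n := ideal_pow_ideal I n.

Lemma completion_le b m n : (m <= n)%N -> eqI m (pi b n) (pi b m).
Proof.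
move=> /subnK <-; elim: (n - m)%N => [|k IH]; first exact: cong_refl.
apply: (cong_trans (In m) _ IH); rewrite addSn.
by apply: (ideal_pow_le (leq_addl k m)); apply: pi_succ.
Qed.

Lemma completion_ext b c : (forall n, eqI n (pi b n) (pi c n)) -> b = c.
Proof.
move=> h; have [d [_ du]] := pi_lim (pi_succ c).
by rewrite -(du b h) -(du c) // => n; apply: cong_refl.
Qed.

Lemma completion0 n : ideal_pow I n (pi 0 n).
Proof. by have := pi_g 0 n; rewrite rmorph0 subr0. Qed.

Lemma completionN b n : eqI n (pi (- b) n) (- pi b n).
Proof.
rewrite opprK; apply: (cong_mem (In n)) (completion0 n).
by apply: (cong_sym (In n)); have := pi_D (- b) b n; rewrite addNr.
Qed.

Lemma completionB b c n : eqI n (pi (b - c) n) (pi b n - pi c n).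
Proof.
apply: (cong_trans (In n) (pi_D _ _ _)).
by apply: (congD (In n)); [apply: cong_refl|apply: completionN].
Qed.

Lemma completion_sum (T : finType) (F : T -> B) n :
  eqI n (pi (\sum_t F t) n) (\sum_t pi (F t) n).
Proof.
apply: (big_rec2 (fun b a => eqI n (pi b n) a)).
  by rewrite subr0; apply: completion0.
move=> t a b _ h; apply: (cong_trans (In n) (pi_D _ _ _)).
by apply: (congD (In n)) h; apply: cong_refl.
Qed.

Lemma completionX b k n : eqI n (pi (b ^+ k) n) (pi b n ^+ k).
Proof.
elim: k => [|k IH]; first by rewrite !expr0 -(rmorph1 g); apply: pi_g.
rewrite !exprS; apply: (cong_trans (In n) (pi_M _ _ _)).
by apply: (congM (In n)) IH; apply: cong_refl.
Qed.

Lemma completion_lim (m : nat) (a : nat -> A) :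
  (forall n, ideal_pow I n (a (n.+1 + m)%N - a (n + m)%N)) ->
  exists b, forall n, eqI n (pi b n) (a (n + m)%N).
Proof.
move=> h; have [b [hb _]] := @pi_lim (fun n => a (n + m)%N) h.
by exists b.
Qed.

Hypothesis hA : noetherian A.

Definition initial_forms (J : set B) (n : nat) : set A :=
  [set a | ideal_pow I n a /\
     exists2 b, J b & ideal_pow I n.+1 (pi b n.+1 - a)].

Lemma initial_forms_ideal J n : is_ideal J -> is_ideal (initial_forms J n).
Proof.
move=> hJ; split.
- split; first by case: (In n).
  by exists 0; [case: hJ|rewrite subr0; apply: completion0].
- move=> a a' [Ia [b Jb h]] [Ia' [b' Jb' h']]; split; first exact: (idealD (In n)).
  exists (b + b'); first exact: (idealD hJ).
  apply: (cong_trans (In n.+1) (pi_D _ _ _)); exact: (congD (In n.+1)).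
- move=> c a [Ia [b Jb h]]; split; first exact: (idealM (In n)).
  exists (g c * b); first exact: (idealM hJ).
  by apply: (cong_trans (In n.+1) (pi_M _ _ _)); apply: (congM (In n.+1)).
Qed.

Lemma initial_forms_mul J n y a : is_ideal J -> I y ->
  initial_forms J n a -> initial_forms J n.+1 (y * a).
Proof.
move=> hJ Iy [Ia [b Jb h]]; split; first exact: ideal_powS.
exists (g y * b); first exact: (idealM hJ).
apply: (cong_trans (In n.+2) (pi_M _ _ _)).
apply: (cong_trans (In n.+2) (y := y * pi b n.+2)).
  by apply: (congM (In n.+2)); [apply: pi_g|apply: cong_refl].
rewrite -mulrBr; apply: ideal_powS => //.
by apply: (cong_trans (In n.+1) _ h); apply: pi_succ.
Qed.

(** The initial forms of an ideal have the Artin-Rees property, so that those of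
    degree at most [m] suffice. The degree [n - m] of the coefficients makes the
    successive corrections below converge. *)
Lemma initial_forms_generators J : is_ideal J ->
  exists (m : nat) (T : finType) (b : T -> B), (forall t, J (b t)) /\
    forall n a, initial_forms J n a -> exists c : T -> A,
      (forall t, ideal_pow I (n - m) (c t)) /\
      ideal_pow I n.+1 (\sum_t c t * pi (b t) n.+1 - a).
Proof.
move=> hJ.
have [m hm] := artin_rees hA hI (fun n => initial_forms_ideal n hJ)
  (fun n a (h : initial_forms J n a) => h.1)
  (fun n y a Iy => initial_forms_mul (n := n) (a := a) hJ Iy).
have one d : exists (T : finType) (b : T -> B), (forall t, J (b t)) /\
    forall a, initial_forms J d a -> exists c : T -> A,
      ideal_pow I d.+1 (\sum_t c t * pi (b t) d.+1 - a).
  have [r [y [Ly yL]]] := noetherian_fg hA (initial_forms_ideal d hJ).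
  have /choice [b hb] : forall i, exists b, J b /\
      ideal_pow I d.+1 (pi b d.+1 - y i).
    by move=> i; case: (Ly i) => _ [b Jb h]; exists b.
  exists 'I_r, b; split=> [t|a /yL [c ->]]; first by case: (hb t).
  exists c; apply: (cong_sum (In d.+1)) => t; rewrite -mulrBr.
  by apply: (idealM (In d.+1)); case: (hb t).
have low k : exists (T : finType) (b : T -> B), (forall t, J (b t)) /\
    forall d a, (d < k)%N -> initial_forms J d a -> exists c : T -> A,
      ideal_pow I d.+1 (\sum_t c t * pi (b t) d.+1 - a).
  elim: k => [|k [T [b [Jb hb]]]].
    by exists void, (fun=> 0); split; [case|].
  have [T' [b' [Jb' hb']]] := one k.
  exists (T + T')%type.
  exists (fun t => match t with inl t => b t | inr t => b' t end).
  split=> [[]//|d a]; rewrite ltnS leq_eqVlt => /orP[/eqP->|dk] La.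
    have [c hc] := hb' a La.
    exists (fun t => match t with inl _ => 0 | inr t => c t end).
    rewrite big_sumType /= big1 ?add0r // => t _; by rewrite mul0r.
  have [c hc] := hb d a dk La.
  exists (fun t => match t with inl t => c t | inr _ => 0 end).
  by rewrite big_sumType /= addrC big1 ?add0r // => t _; rewrite mul0r.
have [T [b [Jb hb]]] := low m.+1.
exists m, T, b; split=> // n a La; have [nm|mn] := leqP n m.
  have [|c hc] := hb n a _ La; first by rewrite ltnS.
  exists c; split=> // t; have -> : (n - m = 0)%N by apply/eqP.
  exact: ideal_pow0.
have [r [c [x [Ic Lx ->]]]] := hm n mn a La.
have /choice [d hd] : forall j, exists d : T -> A,
    ideal_pow I m.+1 (\sum_t d t * pi (b t) m.+1 - x j).
  by move=> j; apply: hb.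
exists (fun t => \sum_j c j * d j t); split=> [t|].
  by apply: (ideal_sum (In _)) => j; apply: (ideal_mulr (In (n - m)%N) _ (Ic j)).
under eq_bigr do rewrite mulr_suml.
rewrite exchange_big /=; apply: (cong_sum (In n.+1)) => j.
have -> : \sum_t c j * d j t * pi (b t) n.+1 - c j * x j
    = c j * (\sum_t d j t * pi (b t) n.+1 - x j).
  by rewrite mulrBr mulr_sumr; congr (_ - _); apply: eq_bigr => t _; rewrite mulrA.
have -> : n.+1 = ((n - m) + m.+1)%N by rewrite addnS subnK // ltnW.
apply: (ideal_powD) => //.
apply: (cong_trans (In m.+1) _ (hd j)); apply: (cong_sum (In m.+1)) => t.
rewrite -mulrBr; apply: (idealM (In m.+1)); apply: completion_le.
by rewrite leq_addl.
Qed.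

(** An element of the ideal is a limit of combinations of the chosen
    generators: each step removes its initial form, and the corrections to the
    coefficients have degrees tending to infinity. *)
Lemma completion_noetherian : noetherian B.
Proof.
apply: fg_noetherian => J hJ.
have [m [T [b [Jb hb]]]] := initial_forms_generators hJ.
exists T, b; split=> // x Jx.
have /choice [step hstep] : forall nz : nat * B, exists c : T -> A,
    (forall t, ideal_pow I (nz.1 - m) (c t)) /\
    (J nz.2 -> ideal_pow I nz.1 (pi nz.2 nz.1) ->
      ideal_pow I nz.1.+1 (pi (nz.2 - \sum_t g (c t) * b t) nz.1.+1)).
  move=> [n z] /=.
  have [[Jz Iz]|h] := pselect (J z /\ ideal_pow I n (pi z n)); last first.
    exists (fun=> 0); split=> [t|Jz Iz]; first by case: (In (n - m)%N).
    by case: h.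
  have Lz : initial_forms J n (pi z n.+1).
    split; first exact: (cong_mem (In n) (pi_succ z n)).
    by exists z => //; apply: cong_refl.
  have [c [Ic hc]] := hb n _ Lz; exists c; split=> // _ _.
  apply: (cong_mem (In n.+1) (completionB _ _ _)).
  apply: (cong_sym (In n.+1)); apply: (cong_trans (In n.+1) _ hc).
  apply: (cong_trans (In n.+1) (completion_sum _ _)).
  apply: (cong_sum (In n.+1)) => t.
  apply: (cong_trans (In n.+1) (pi_M _ _ _)).
  by apply: (congM (In n.+1)); [apply: pi_g|apply: cong_refl].
pose z := fix z n := if n is n'.+1
  then z n' - \sum_t g (step (n', z n') t) * b t else x.
pose C n t := \sum_(0 <= l < n) step (l, z l) t.
have zE n : z n = x - \sum_t g (C n t) * b t.
  elim: n => [|n IH] /=.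
    rewrite big1 ?subr0 // => t _.
    by rewrite /C big_geq // rmorph0 mul0r.
  rewrite {1}IH -addrA -opprD; congr (_ - _); rewrite -big_split /=.
  by apply: eq_bigr => t _; rewrite /C big_nat_recr //= rmorphD mulrDl.
have Jz n : J (z n).
  rewrite zE; apply: (idealB hJ) => //; apply: (ideal_sum hJ) => t.
  exact: (idealM hJ).
have Iz n : ideal_pow I n (pi (z n) n).
  elim: n => [|n IH]; first exact: ideal_pow0.
  by case: (hstep (n, z n)) => _ /(_ (Jz n) IH).
have /choice [beta hbeta] : forall t, exists v, forall n,
    eqI n (pi v n) (C (n + m)%N t).
  move=> t; apply: (@completion_lim m (fun n => C n t)) => n.
  rewrite addSn /C big_nat_recr //= addrAC subrr add0r.
  case: (hstep ((n + m)%N, z (n + m)%N)) => /(_ t) /=.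
  by rewrite addnK.
exists beta; apply: completion_ext => n.
have h1 : eqI n (pi x n) (pi (\sum_t g (C (n + m)%N t) * b t) n).
  have := Iz (n + m)%N => /(ideal_pow_le (leq_addr m n)).
  move=> /(cong_mem (In n) (cong_sym (In n) (completion_le _ (leq_addr m n)))).
  rewrite zE => h.
  exact: (cong_mem (In n) (cong_sym (In n) (completionB _ _ _)) h).
apply: (cong_trans (In n) h1); apply: (cong_trans (In n) (completion_sum _ _)).
apply: (cong_sym (In n)); apply: (cong_trans (In n) (completion_sum _ _)).
apply: (cong_sum (In n)) => t.
apply: (cong_trans (In n) (pi_M _ _ _)); apply: (cong_sym (In n)).
apply: (cong_trans (In n) (pi_M _ _ _)); apply: (congM (In n)); last exact: cong_refl.
apply: (cong_trans (In n) (pi_g _ _)); apply: (cong_sym (In n)).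
exact: hbeta.
Qed.

(** *** Finiteness over the p-th powers *)

Variable p : nat.
Hypotheses (p_prime : prime p) (pA : p%:R = 0 :> A) (fA : ffinite p A).

(** A high power of [I] lies in the ideal generated by the p-th powers of
    elements of [I], since [A] is noetherian. *)
Lemma ideal_pow_ffinite : exists (T : finType) (x : T -> A) (N : nat),
  (0 < N)%N /\ forall k a, ideal_pow I (N * k) a ->
    exists u : T -> A, (forall t, ideal_pow I k (u t)) /\
      a = \sum_t u t ^+ p * x t.
Proof.
have [T [x hx]] := fA; exists T, x.
have hD a b : (a + b) ^+ p = a ^+ p + b ^+ p :> A by apply: exprDp.
pose E k : set A := [set a | exists u : T -> A,
  (forall t, ideal_pow I k (u t)) /\ a = \sum_t u t ^+ p * x t].
have EI k : is_ideal (E k).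
  have [I0 ID IM] := In k; split.
  - exists (fun=> 0); split=> //; rewrite big1 // => t _.
    by rewrite expr0n eqn0Ngt prime_gt0 // mul0r.
  - move=> _ _ [u [Iu ->]] [v [Iv ->]]; exists (fun t => u t + v t).
    split=> [t|]; first exact: ID.
    by rewrite -big_split; apply: eq_bigr => t _; rewrite hD mulrDl.
  - move=> a _ [u [Iu ->]].
    have /choice [d hd] : forall t, exists d : T -> A,
        a * x t = \sum_s d s ^+ p * x s by move=> t; apply: hx.
    exists (fun s => \sum_t d t s * u t); split=> [s|].
      by apply: (ideal_sum (In k)) => t; apply: IM.
    have sumX (F : T -> A) : (\sum_t F t) ^+ p = \sum_t F t ^+ p.
      apply: (big_morph (fun a => a ^+ p) hD).
      by rewrite expr0n eqn0Ngt prime_gt0.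
    under [RHS]eq_bigr do rewrite sumX mulr_suml.
    rewrite exchange_big mulr_sumr; apply: eq_bigr => t _.
    rewrite mulrCA hd mulr_sumr; apply: eq_bigr => s _.
    by rewrite exprMn_comm ?mulrA ?(mulrC (u t ^+ p)) //; apply: mulrC.
have ES y k a : I y -> E k a -> E k.+1 (y ^+ p * a).
  move=> Iy [u [Iu ->]]; exists (fun t => y * u t); split=> [t|].
    exact: ideal_powS.
  rewrite mulr_sumr; apply: eq_bigr => t _.
  by rewrite mulrA -exprMn_comm //; apply: mulrC.
(* The ideal [G] of all [a] that multiply each [E k] into [E k.+1] contains the
   p-th powers of elements of [I], so that a prime ideal over [G]
   contains [I]. *)
pose G : set A := [set a | forall k b, E k b -> E k.+1 (a * b)].
have GI : is_ideal G.
  split.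
  - by move=> k b _; rewrite mul0r; case: (EI k.+1).
  - by move=> a b ha hb k c Ec; rewrite mulrDl; apply: (idealD (EI _)); auto.
  - by move=> a b hb k c Ec; rewrite -mulrA; apply: (idealM (EI _)); auto.
have [N hN] : exists N, ideal_pow I N `<=` G.
  apply: contrapT => h.
  have [|||P [GP hP]] := @exists_prime A
    [set K | exists n, ideal_pow I n `<=` K] G hA GI h.
  - by exists 0%N.
  - by move=> K L _ _ [n hn] KL; exists n; apply: subset_trans KL.
  - move=> K L M hK hL hM [n hn] [n' hn'] KLM; exists (n + n')%N.
    by apply: ideal_pow_split => // a b /hn Ka /hn' Lb; apply: KLM.
  apply: hP; exists 1%N; apply: (@ideal_pow_ind A I 0) => [|a b Pa Pb|a b Ia _].
  - by case: (prime_ideal P).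
  - exact: (idealD (prime_ideal P)).
  apply: (ideal_mulr (prime_ideal P)); have Pa : prime_set P (a ^+ p).
    by apply: GP => k c; apply: ES.
  elim: (p) Pa => [|k IHk]; first by rewrite expr0 => /(prime_proper (s := P)).
  by rewrite exprS => /(prime_prime (s := P)) [].
exists N.+1; split=> //.
have hN1 : ideal_pow I N.+1 `<=` G.
  by apply: subset_trans hN; apply: ideal_pow_le.
elim=> [|k IH] a.
  move=> _; have [c ->] := hx a; exists c; split=> // t; exact: ideal_pow0.
rewrite mulnS; apply: (@ideal_pow_split _ _ _ _ (E k.+1)) => // u v Iu Iv.
by apply: (hN1 u Iu k); apply: IH.
Qed.

(** Along a sequence in [A] that converges to [b], the increments have small
    coefficients; these are summed before taking p-th powers. *)
Lemma completion_ffinite : ffinite p B.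
Proof.
have [T [x [N [N0 hN]]]] := ideal_pow_ffinite; exists T, (g \o x) => b.
have hD a b' : (a + b') ^+ p = a ^+ p + b' ^+ p :> A by apply: exprDp.
pose a k := pi b (N * k)%N.
have /choice [u hu] : forall k, exists u : T -> A,
    (forall t, ideal_pow I k (u t)) /\ a k.+1 - a k = \sum_t u t ^+ p * x t.
  by move=> k; apply: hN; apply: completion_le; rewrite leq_mul2l leqnSn orbT.
have [u0 [_ hu0]] : exists u : T -> A, (forall t, ideal_pow I 0 (u t)) /\
    a 0%N = \sum_t u t ^+ p * x t.
  by apply: hN; rewrite muln0; apply: ideal_pow0.
pose U n t := u0 t + \sum_(0 <= l < n) u l t.
have aE n : a n = \sum_t U n t ^+ p * x t.
  elim: n => [|n IH].
    by rewrite hu0; apply: eq_bigr => t _; rewrite /U big_geq // addr0.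
  rewrite -(subrK (a n) (a n.+1)) (hu n).2 {1}IH addrC -big_split /=.
  by apply: eq_bigr => t _; rewrite /U big_nat_recr //= addrA [in RHS]hD mulrDl.
have /choice [beta hbeta] : forall t, exists v, forall n, eqI n (pi v n) (U n t).
  move=> t; have [n|v hv] := @completion_lim 0 (fun n => U n t).
    rewrite !addn0 /U big_nat_recr //= opprD addrACA subrr add0r.
    by rewrite addrAC subrr add0r; case: (hu n).
  by exists v => n; have := hv n; rewrite addn0.
exists beta; apply: completion_ext => n.
apply: (cong_sym (In n)); apply: (cong_trans (In n) (completion_sum _ _)).
apply: (cong_trans (In n) (y := a n)); last first.
  by apply: completion_le; rewrite -{1}(mul1n n) leq_mul2r N0 orbT.
rewrite aE; apply: (cong_sum (In n)) => t.
apply: (cong_trans (In n) (pi_M _ _ _)); apply: (congM (In n)); last exact: pi_g.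
apply: (cong_trans (In n) (completionX _ _ _)).
elim: (p) => [|k IHk]; first by rewrite !expr0; apply: cong_refl.
by rewrite !exprS; apply: (congM (In n)).
Qed.

End Completion.

(** ** Geometric algebras *)

Theorem geometric_algebra_noetherian_ffinite (k : fieldType) (p : nat)
    (A : comPzRingType) (f : k -> A) :
  p \in [pchar k] -> perfect_field p k -> geometric_algebra f ->
  [/\ p%:R = 0 :> A, noetherian A & ffinite p A].
Proof.
move=> /andP[p_prime /eqP pk] hk; elim=> {A f}.
- move=> A f fT; have pA : p%:R = 0 :> A by rewrite -(rmorph_nat f) pk rmorph0.
  split=> //; first exact: (finite_type_noetherian fT).
  exact: (finite_type_ffinite fT p_prime pA hk).
- move=> A B f S g _ [pA nA fA] hS hg; split.
  + by rewrite -(rmorph_nat g) pA rmorph0.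
  + exact: (localization_noetherian hg nA).
  + exact: (localization_ffinite hg (prime_gt0 p_prime) fA).
- move=> A B f I g _ [pA nA fA] hI [pi [h1 h2 h3 h4 h5]]; split.
  + by rewrite -(rmorph_nat g) pA rmorph0.
  + exact: (completion_noetherian hI h1 h2 h3 h4 h5 nA).
  + exact: (completion_ffinite h1 h2 h3 h4 h5 nA p_prime pA fA).
Qed.

(** * Linear algebra at a prime ideal *)

Section AtPrime.
Variables (R : comPzRingType) (P : Spec R).
Local Notation inP := (prime_set P).
Let hP : is_ideal inP := prime_ideal P.

Lemma notin_prime1 : ~ inP 1.
Proof. exact: prime_proper. Qed.

Lemma notin_primeM a b : ~ inP a -> ~ inP b -> ~ inP (a * b).
Proof. by move=> ha hb /(prime_prime (s := P)) []. Qed.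

Lemma notin_primeX a n : ~ inP a -> ~ inP (a ^+ n).
Proof.
move=> ha; elim: n => [|n IH]; first exact: notin_prime1.
by rewrite exprS; apply: notin_primeM.
Qed.

Lemma finite_uniform (T : finType) (Q : T -> R -> Prop) :
  (forall t, exists s, ~ inP s /\ Q t s) ->
  (forall t s s', Q t s -> Q t (s * s')) ->
  exists s, ~ inP s /\ forall t, Q t s.
Proof.
move=> /choice [s hs] hQ; exists (\prod_t s t); split; last first.
  by move=> t; rewrite (bigD1 t) //=; apply: hQ; case: (hs t).
apply: (big_ind (fun a => ~ inP a)); first exact: notin_prime1.
  exact: notin_primeM.
by move=> t _; case: (hs t).
Qed.

(** Gaussian elimination over the domain [R / P]. *)
Lemma rows_dependent (I : finType) (n : nat) (S : {set I}) (A : I -> nat -> R) :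
  (n < #|S|)%N -> exists b : I -> R, (exists2 i, i \in S & ~ inP (b i)) /\
    forall j, (j < n)%N -> inP (\sum_(i in S) b i * A i j).
Proof.
elim: n S A => [|n IH] S A nS.
  have [i iS] := card_gt0P nS; exists (fun=> 1); split=> //.
  by exists i => //; apply: notin_prime1.
have [h|/existsNP [i0 /not_implyP [i0S nA]]] :=
    pselect (forall i, i \in S -> inP (A i n)).
  have [b [nb hb]] := IH S A (ltnW nS); exists b; split=> // j.
  rewrite ltnS leq_eqVlt => /orP[/eqP->|]; last exact: hb.
  apply: (big_ind inP); first by case: hP.
    exact: (idealD hP).
  by move=> i /h hi; apply: (idealM hP).
pose A' i j := A i0 n * A i j - A i n * A i0 j.
have [|b [[i1 i1S nb] hb]] := IH (S :\ i0)%SET A'.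
  by rewrite (cardsD1 i0) i0S in nS.
exists (fun i => if i == i0 then - \sum_(k in (S :\ i0)%SET) b k * A k n
                 else A i0 n * b i).
have E j : \sum_(i in S) (if i == i0 then - \sum_(k in (S :\ i0)%SET) b k * A k n
    else A i0 n * b i) * A i j = \sum_(i in (S :\ i0)%SET) b i * A' i j.
  rewrite (big_setD1 i0) //= eqxx mulNr mulr_suml -sumrN -big_split /=.
  apply: eq_bigr => i; rewrite !inE => /andP[/negbTE -> _].
  by rewrite /A'; ring.
split.
  exists i1; first by move: i1S; rewrite !inE => /andP[].
  by move: i1S; rewrite !inE => /andP[/negbTE -> _]; apply: notin_primeM.
move=> j; rewrite E ltnS leq_eqVlt => /orP[/eqP->|]; last exact: hb.
by rewrite big1 ?hP //; [case: hP | move=> i _; rewrite /A'; ring].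
Qed.

Section Independence.
Variables (V : lmodType R) (Z : set V).

(** Independence and span are those of the vector space obtained from [V / Z]
    by localization at [P]. *)
Definition indep (J : finType) (v : J -> V) : Prop :=
  forall a : J -> R, Z (\sum_j a j *: v j) -> forall j, inP (a j).

Definition sat_span (J : finType) (v : J -> V) : set V :=
  [set m | exists s, ~ inP s /\ exists a : J -> R, Z (s *: m - \sum_j a j *: v j)].

Lemma indep_comp (J J' : finType) (h : J' -> J) (v : J -> V) :
  injective h -> indep v -> indep (v \o h).
Proof.
move=> h_inj iv a Za l.
have -> : a l = \sum_(l' | h l' == h l) a l'.
  by rewrite (big_pred1 l) // => l'; apply: (inj_eq h_inj).
apply: (iv (fun k => \sum_(l' | h l' == k) a l')).
suff -> : \sum_k (\sum_(l' | h l' == k) a l') *: v k = \sum_l a l *: (v \o h) l.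
  exact: Za.
under eq_bigr do rewrite scaler_suml.
rewrite (exchange_big_dep xpredT) //=; apply: eq_bigr => l' _.
by rewrite (big_pred1 (h l')) // => k; rewrite eq_sym.
Qed.

Hypothesis hZ : submod Z.

Lemma sat_span_mem (J : finType) (v : J -> V) j : sat_span v (v j).
Proof.
exists 1; split; first exact: notin_prime1.
exists (fun i => (i == j)%:R); rewrite (bigD1 j) //= eqxx !scale1r big1.
  by rewrite addr0 subrr; case: hZ.
by move=> i /negbTE ->; rewrite scale0r.
Qed.

Lemma sat_spanD (J : finType) (v : J -> V) s m m' (a a' : J -> R) :
  Z (s *: m - \sum_j a j *: v j) -> Z (s *: m' - \sum_j a' j *: v j) ->
  Z (s *: (m + m') - \sum_j (a j + a' j) *: v j).
Proof.
move=> h h'.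
have -> : s *: (m + m') - \sum_j (a j + a' j) *: v j =
    s *: m - \sum_j a j *: v j + (s *: m' - \sum_j a' j *: v j).
  under eq_bigr do rewrite scalerDl.
  by rewrite big_split /= scalerDr opprD addrACA.
exact: (opsubD hZ).
Qed.

Lemma sat_spanZ (J : finType) (v : J -> V) c s m (a : J -> R) :
  Z (s *: m - \sum_j a j *: v j) -> Z (c *: (s *: m) - \sum_j (c * a j) *: v j).
Proof.
move=> h; have -> : c *: (s *: m) - \sum_j (c * a j) *: v j =
    c *: (s *: m - \sum_j a j *: v j).
  rewrite scalerBr scaler_sumr; congr (_ - _).
  by apply: eq_bigr => j _; rewrite scalerA.
exact: (submodZ _ hZ).
Qed.

Lemma sat_span_submod (J : finType) (v : J -> V) : submod (sat_span v).
Proof.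
apply/submodP; split.
- exists 1; split; first exact: notin_prime1.
  exists (fun=> 0); rewrite big1 => [|j _]; last by rewrite scale0r.
  by rewrite scaler0 subrr; case: hZ.
- move=> x y [s [ns [a ha]]] [s' [ns' [a' ha']]].
  exists (s * s'); split; first exact: notin_primeM.
  exists (fun j => s' * a j + s * a' j); apply: sat_spanD.
  + by rewrite mulrC -scalerA; apply: sat_spanZ.
  + by rewrite -scalerA; apply: sat_spanZ.
- move=> c x [s [ns [a ha]]]; exists s; split=> //.
  exists (fun j => c * a j); rewrite scalerA mulrC -scalerA.
  exact: sat_spanZ.
Qed.

(** Equality of dimensions turns independence into generation. *)
Lemma indep_span (J : finType) (u v : J -> V) (y : V) :
  (forall a j, inP a -> Z (a *: u j)) -> indep v ->
  (forall j, sat_span u (v j)) -> sat_span u y -> sat_span v y.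
Proof.
move=> PB iv uv uy; pose I := (unit + J)%type.
pose y' (i : I) := match i with inl _ => y | inr j => v j end.
have /choice [s hs] : forall i, exists s, ~ inP s /\
    exists a : J -> R, Z (s *: y' i - \sum_j a j *: u j).
  by case=> [[]|j]; [apply: uy|apply: uv].
have /choice [a ha] : forall i, exists a : J -> R,
    Z (s i *: y' i - \sum_j a j *: u j) by move=> i; case: (hs i).
pose A i n := if insub n : option 'I_#|J| is Some k then a i (enum_val k) else 0.
have [|b [[i0 _ nb] hb]] := @rows_dependent I #|J| [set: I]%SET A.
  by rewrite cardsT card_sum card_unit.
have {}hb j : inP (\sum_i b i * a i j).
  have := hb (enum_rank j) (ltn_ord _); rewrite (eq_bigl xpredT); last first.
    by move=> i; rewrite inE.
  congr inP; apply: eq_bigr => i _; congr (_ * _).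
  by rewrite /A valK enum_rankK.
have Zu i : Z (b i *: (s i *: y' i) - \sum_j (b i * a i j) *: u j).
  exact: sat_spanZ.
have Zsum : Z (\sum_i (b i * s i) *: y' i).
  have -> : \sum_i (b i * s i) *: y' i =
      \sum_i (b i *: (s i *: y' i) - \sum_j (b i * a i j) *: u j)
      + \sum_j (\sum_i b i * a i j) *: u j.
    rewrite sumrB; under [X in _ + X]eq_bigr do rewrite scaler_suml.
    rewrite [X in _ - _ + X]exchange_big /= subrK.
    by apply: eq_bigr => i _; rewrite scalerA.
  apply: (opsubD hZ); first by apply: (opsub_sum _ hZ) => i _; apply: Zu.
  by apply: (opsub_sum _ hZ) => j _; apply: PB.
have Zy : Z ((b (inl tt) * s (inl tt)) *: y +
             \sum_j (b (inr j) * s (inr j)) *: v j).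
  move: Zsum; rewrite big_sumType /=.
  by rewrite (big_pred1 tt) // => -[].
have nb0 : ~ inP (b (inl tt)).
  move=> b0; have Z0 : Z ((b (inl tt) * s (inl tt)) *: y).
    rewrite -scalerA -(subrK (\sum_j (b (inl tt) * a (inl tt) j) *: u j)
      (_ *: _)).
    apply: (opsubD hZ); first exact: (Zu (inl tt)).
    by apply: (opsub_sum _ hZ) => j _; apply: PB; apply: (ideal_mulr hP).
  have Zv : Z (\sum_j (b (inr j) * s (inr j)) *: v j).
    rewrite -[X in Z X](addKr ((b (inl tt) * s (inl tt)) *: y)).
    by apply: (opsubD hZ) => //; apply: (opsubN hZ).
  case: i0 nb => [[]//|j]; apply.
  have /(prime_prime (s := P)) [//|] := iv _ Zv j.
  by case: (hs (inr j)).
exists (b (inl tt) * s (inl tt)); split.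
  by apply: notin_primeM => //; case: (hs (inl tt)).
exists (fun j => - (b (inr j) * s (inr j))).
under eq_bigr do rewrite scaleNr.
by rewrite sumrN opprK.
Qed.

(** A family whose span is maximal is a basis at [P], and the chain condition
    makes the denominator [s] uniform. *)
Lemma exists_basis (B : set V) : macc B -> submod B ->
  (forall a m, inP a -> B m -> Z (a *: m)) ->
  exists (r : nat) (u : 'I_r -> V) (s : R),
  [/\ (forall i, B (u i)), indep u, ~ inP s
    & forall m, B m -> exists a : 'I_r -> R, Z (s *: m - \sum_i a i *: u i)].
Proof.
move=> accB hB PB.
have [||_ [r [u [Bu iu ->]]] hmax] := @acc_max V (@scalings R V) B
  [set N | exists (r : nat) (u : 'I_r -> V),
    [/\ (forall i, B (u i)), indep u & N = B `&` sat_span u]] accB.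
- move=> _ [r [u [Bu iu ->]]]; split; last by move=> m [].
  exact: (opsubI hB (sat_span_submod u)).
- exists (B `&` sat_span (fun i : 'I_0 => 0)), 0%N, (fun=> 0).
  by split=> [[]|a _ []|].
have Bsat : B `<=` sat_span u.
  move=> m Bm; apply: contrapT => num.
  pose u' (i : 'I_r.+1) := oapp u m (unlift ord0 i).
  have sumE (a : 'I_r.+1 -> R) : \sum_i a i *: u' i =
      a ord0 *: m + \sum_i a (lift ord0 i) *: u i.
    rewrite big_ord_recl /u' unlift_none; congr (_ + _).
    by apply: eq_bigr => i _; rewrite liftK.
  suff [_ su'] : (B `&` sat_span u) m by [].
  apply: (hmax (B `&` sat_span u')).
  - exists r.+1, u'; split=> // [i|a Za].
      by rewrite /u'; case: unliftP => [j _|_] /=.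
    rewrite sumE in Za.
    have a0 : inP (a ord0).
      apply: contrapT => na0; apply: num; exists (a ord0); split=> //.
      exists (fun i => - a (lift ord0 i)).
      by under eq_bigr do rewrite scaleNr; rewrite sumrN opprK.
    have Za' : Z (\sum_i a (lift ord0 i) *: u i).
      rewrite -[X in Z X](addKr (a ord0 *: m)); apply: (opsubD hZ) => //.
      by apply: (opsubN hZ); apply: PB.
    move=> i; have [j ->|->//] := unliftP ord0 i; exact: iu Za' j.
  - move=> x [Bx [s [ns [a ha]]]]; split=> //; exists s; split=> //.
    exists (fun i => oapp a 0 (unlift ord0 i)).
    rewrite sumE unlift_none /= scale0r add0r.
    by under eq_bigr do rewrite liftK.
  - split=> //; have := sat_span_mem u' ord0.
    by rewrite {2}/u' unlift_none.
have [|||s ns hs] := @acc_directed V (@scalings R V) B R [set s | ~ inP s]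
  (fun s => B `&` [set m | exists a : 'I_r -> R, Z (s *: m - \sum_i a i *: u i)])
  accB.
- by exists 1; apply: notin_prime1.
- move=> s ns; split; last by move=> m [].
  apply: (opsubI hB); apply/submodP; split.
  + exists (fun=> 0); rewrite big1 => [|j _]; last by rewrite scale0r.
    by rewrite scaler0 subrr; case: hZ.
  + by move=> x y [a ha] [b hb]; exists (fun i => a i + b i); apply: sat_spanD.
  + move=> c x [a ha]; exists (fun i => c * a i).
    by rewrite scalerA mulrC -scalerA; apply: sat_spanZ.
- move=> s s' ns ns'; exists (s * s'); split; first exact: notin_primeM.
  + move=> m [Bm [a ha]]; split=> //; exists (fun i => s' * a i).
    by rewrite mulrC -scalerA; apply: sat_spanZ.
  + move=> m [Bm [a ha]]; split=> //; exists (fun i => s * a i).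
    by rewrite -scalerA; apply: sat_spanZ.
exists r, u, s; split=> // m Bm; have [s' [ns' h']] := Bsat m Bm.
by have [] := hs s' ns' m.
Qed.

End Independence.

(** Nakayama's lemma: if [sigma I] is contained in [I I + P], the determinant
    of the resulting linear system is in [P] and congruent to a power of
    [sigma] modulo [I]. *)
Lemma nakayama_power (I : set R) n (y : 'I_n -> R) (A : 'M[R]_n) sigma d :
  is_ideal I -> (forall x, I x -> exists a : 'I_n -> R, x = \sum_i a i * y i) ->
  (forall i j, I (A i j)) ->
  (forall i, inP (sigma * y i - \sum_j A i j * y j)) ->
  inP `<=` I -> I d -> ~ inP d -> I (sigma ^+ n).
Proof.
move=> hI yI IA hA PI Id nd.
pose X := sigma%:M - A.
have detP : inP (\det X).
  have hy i : inP (\det X * y i).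
    have -> : \det X * y i = ((\det X)%:M *m (\col_j y j)) i ord0.
      by rewrite mul_scalar_mx !mxE.
    rewrite -mul_adj_mx -mulmxA mxE; apply: (ideal_sum hP) => j.
    apply: (idealM hP); rewrite mulmxBl mul_scalar_mx !mxE.
    by under eq_bigr do rewrite mxE; apply: hA.
  have [a da] := yI d Id.
  have : inP (\det X * d).
    rewrite da mulr_sumr; apply: (ideal_sum hP) => i.
    by rewrite mulrCA; apply: (idealM hP).
  by move=> /(prime_prime (s := P)) [].
rewrite -det_scalar; apply: (cong_mem hI _ (PI _ detP)).
apply: (cong_sym hI); rewrite /determinant; apply: (cong_sum hI) => s.
apply: (congM hI); first exact: cong_refl.
apply: (big_rec2 (fun a b => I (a - b))); first exact: cong_refl.
move=> i a b _ h; apply: (congM hI) => //; rewrite !mxE addrAC subrr add0r.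
by apply: (idealN hI).
Qed.

End AtPrime.

(** * Chains of Cartier modules over a ring *)

Section CartierChain.
Variables (R : comPzRingType) (q : nat) (phi : {rmorphism R -> R}).
Hypotheses (q_gt1 : (1 < q)%N) (phiE : forall a, phi a = a ^+ q).
Hypotheses (nR : noetherian R) (fR : ffinite q R).
Variables (M : lmodType R) (kappa : {additive M -> M}).
Hypothesis kappaZ : forall a m, kappa (a ^+ q *: m) = a *: kappa m.

Local Notation FR := (restriction_of_scalars phi R^o).

Lemma frobenius_macc : macc ([set: FR] : set FR).
Proof.
have [T [x hx]] := fR; apply: (@fg_macc R FR _ T x nR) => a _.
have [c cE] := hx a; exists c; rewrite [LHS]cE.
by apply: eq_bigr => t _; rewrite -phiE.
Qed.

Section TestElement.
Variables (P : Spec R) (B Z : set M).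
Local Notation inP := (prime_set P).
Hypotheses (accB : macc B) (hB : submod B) (hZ : submod Z).
Hypothesis satZ : forall s m, ~ inP s -> Z (s *: m) -> Z m.
Hypothesis PB : forall a m, inP a -> B m -> Z (a *: m).
Hypothesis kB : forall m, B m -> B (kappa m).
Hypothesis kZ : forall m, Z m -> Z (kappa m).
Hypothesis nondeg : forall m, (forall a, Z (kappa (a *: m))) -> Z m.

(** Near [P] the ring [R / P] is free over its q-th powers, as every finitely
    generated module over a domain is generically free. *)
Lemma frobenius_basis : exists (t : nat) (x : 'I_t -> R) (s : R),
  [/\ (forall a, inP (\sum_j a j ^+ q * x j) -> forall j, inP (a j)), ~ inP s
    & forall z, exists a : 'I_t -> R, inP (s ^+ q * z - \sum_j a j ^+ q * x j)].
Proof.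
have hP : submod (inP : set FR).
  have [P0 PD PM] := prime_ideal P; apply/submodP; split=> // a x Px.
  exact: PM.
have [||t [x [s [_ ix ns hs]]]] := exists_basis (P := P) hP frobenius_macc.
- by apply/submodP.
- move=> a m Pa _; rewrite /GRing.scale /= /ros_scale phiE.
  apply: (ideal_mulr (prime_ideal P)); case: (q) q_gt1 => // q' _.
  by rewrite exprS; apply: (ideal_mulr (prime_ideal P)).
have sumE (a : 'I_t -> R) :
    \sum_j a j ^+ q * x j = \sum_j a j *: (x j : FR) :> FR.
  by apply: eq_bigr => j _; rewrite -phiE.
exists t, x, s; split=> // [a|z]; first by rewrite sumE; apply: ix.
by have [//|a ha] := hs z; exists a; rewrite sumE -phiE.
Qed.

(** Maps from [R] to [B] that are linear over the q-th powers are given by their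
    values at the [x i], so that they form [t] copies of [B]. The maps
    [a |-> kappa (a w)] have the same dimension, [w] ranging over [B] with [R]
    acting through q-th powers, and are determined by [w] by nondegeneracy.
    Hence the coordinate functions are among them. *)
Lemma dual_basis (t : nat) (x : 'I_t -> R) (s : R) :
  (forall a, inP (\sum_j a j ^+ q * x j) -> forall j, inP (a j)) -> ~ inP s ->
  (forall z, exists a : 'I_t -> R, inP (s ^+ q * z - \sum_j a j ^+ q * x j)) ->
  exists s', ~ inP s' /\ forall j m, B m -> exists w, B w /\
    forall i, Z (kappa (x i *: w) - (if i == j then s' *: m else 0)).
Proof.
move=> ix ns hx; have [r [u [s2 [Bu iu ns2 hu]]]] := exists_basis hZ accB hB PB.
pose delta j (m : M) : 'I_t -> M := fun i => if i == j then m else 0.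
pose ZE : set ('I_t -> M) := [set f | forall i, Z (f i)].
have hZE : submod ZE.
  apply/submodP; split=> [i|f h hf hh i|a f hf i].
  - by case: hZ.
  - exact: (opsubD hZ).
  - exact: (submodZ _ hZ).
pose U (jl : 'I_t * 'I_r) := delta jl.1 (u jl.2).
pose comb (a : 'I_t * 'I_r -> R) := \sum_jl a jl ^+ q *: (x jl.1 *: u jl.2).
pose V (jl : 'I_t * 'I_r) : 'I_t -> M :=
  fun i => kappa (x i *: (x jl.1 *: u jl.2)).
have combE a i : (\sum_jl a jl *: V jl) i = kappa (x i *: comb a).
  rewrite fct_sumE scaler_sumr raddf_sum; apply: eq_bigr => jl _.
  by rewrite scalerA mulrC -scalerA kappaZ.
have Bcomb a : B (comb a).
  apply: (opsub_sum _ hB) => jl _; apply: (submodZ _ hB); exact: (submodZ _ hB).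
have spanU (f : 'I_t -> M) : (forall i, B (f i)) -> sat_span P ZE U f.
  move=> Bf; exists s2; split=> //.
  have /choice [a ha] : forall i, exists a : 'I_r -> R,
      Z (s2 *: f i - \sum_l a l *: u l) by move=> i; apply: hu.
  exists (fun jl => a jl.1 jl.2) => i; rewrite !fctE fct_sumE.
  have -> : \sum_jl (a jl.1 jl.2 *: U jl) i = \sum_l a i l *: u l.
    rewrite -(pair_bigA _ (fun j l => (a j l *: U (j, l)) i)) /=.
    rewrite (bigD1 i) //= [X in _ + X]big1 ?addr0.
      by apply: eq_bigr => l _; rewrite fctE /U /delta /= eqxx.
    move=> j ji; apply: big1 => l _.
    by rewrite fctE /U /delta /= eq_sym (negbTE ji) scaler0.
  exact: ha.
have Zcomb (a : 'I_t * 'I_r -> R) : Z (comb a) -> forall jl, inP (a jl).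
  move=> Za [j l].
  have E : comb a = \sum_l (\sum_j a (j, l) ^+ q * x j) *: u l.
    transitivity (\sum_j \sum_l a (j, l) ^+ q *: (x j *: u l)).
      by rewrite pair_bigA; apply: eq_bigr => -[].
    rewrite exchange_big /=; apply: eq_bigr => l' _; rewrite scaler_suml.
    by apply: eq_bigr => j' _; rewrite scalerA.
  rewrite E in Za; exact: ix (iu _ Za l) j.
have indV : indep P ZE V.
  move=> a Za; apply: Zcomb; apply: nondeg => b.
  have [c hc] := hx b; apply: (satZ ns); rewrite -kappaZ scalerA.
  rewrite -(subrK (\sum_j c j ^+ q * x j) (s ^+ q * b)) scalerDl raddfD.
  apply: (opsubD hZ); first by apply: kZ; apply: PB.
  rewrite scaler_suml raddf_sum; apply: (opsub_sum _ hZ) => j _.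
  rewrite -scalerA kappaZ; apply: (submodZ _ hZ).
  by rewrite -combE; apply: Za.
have PU a jl : inP a -> ZE (a *: U jl).
  move=> Pa i; rewrite fctE /U /delta; case: eqP => _; first exact: PB.
  by rewrite scaler0; case: hZ.
have one j m : B m -> exists s', ~ inP s' /\ exists w, B w /\
    forall i, Z (kappa (x i *: w) - (if i == j then s' *: m else 0)).
  move=> Bm; have [||s' [ns' [a ha]]] := indep_span hZE (y := delta j m) PU indV.
  - by move=> jl; apply: spanU => i; apply: kB; do 2!apply: (submodZ _ hB).
  - apply: spanU => i; rewrite /delta; case: eqP => // _; by case: hB.
  exists s'; split=> //; exists (comb a); split=> // i.
  have : Z (- (s' *: delta j m i - (\sum_jl a jl *: V jl) i)).
    exact: (opsubN hZ (ha i)).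
  by rewrite combE opprB /delta; case: eqP => // _; rewrite scaler0.
apply: finite_uniform => [j|j s' s'' hs' m Bm]; last first.
  have [w [Bw hw]] := hs' m Bm; exists (s'' ^+ q *: w).
  split=> [|i]; first exact: (submodZ _ hB).
  rewrite scalerA (mulrC (x i)) -(scalerA (s'' ^+ q)) kappaZ.
  have -> : (if i == j then (s' * s'') *: m else 0) =
      s'' *: (if i == j then s' *: m else 0).
    by case: eqP; rewrite ?scaler0 // mulrC scalerA.
  by rewrite -scalerBr; apply: (submodZ _ hZ).
pose D s' := [set m | B m /\ exists w, B w /\
    forall i, Z (kappa (x i *: w) - (if i == j then s' *: m else 0))].
have [|||s' ns' hs'] := @acc_directed M (@scalings R M) B R [set s | ~ inP s] D accB.
- by exists 1; apply: notin_prime1.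
- move=> s' _; split; last by move=> m [].
  apply/submodP; split.
  + split; first by case: hB.
    exists 0; split=> [|i]; first by case: hB.
    by rewrite !scaler0 raddf0; case: eqP => _; rewrite subrr; case: hZ.
  + move=> m m' [Bm [w [Bw hw]]] [Bm' [w' [Bw' hw']]].
    split; first exact: (opsubD hB).
    exists (w + w'); split=> [|i]; first exact: (opsubD hB).
    have := opsubD hZ (hw i) (hw' i); rewrite addrACA -opprD !scalerDr (raddfD kappa).
    by case: eqP => // _; rewrite addr0.
  + move=> c m [Bm [w [Bw hw]]]; split; first exact: (submodZ _ hB).
    exists (c ^+ q *: w); split=> [|i]; first exact: (submodZ _ hB).
    have := submodZ c hZ (hw i); rewrite scalerBr -kappaZ !scalerA.
    rewrite (mulrC (c ^+ q)).
    by case: eqP => _; rewrite ?scaler0 // !scalerA (mulrC c).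
- move=> s1 s3 ns1 ns3; exists (s1 * s3); split; first exact: notin_primeM.
  + move=> m [Bm [w [Bw hw]]]; split=> //.
    exists (s3 ^+ q *: w); split=> [|i]; first exact: (submodZ _ hB).
    have := submodZ s3 hZ (hw i); rewrite scalerBr -kappaZ !scalerA.
    rewrite (mulrC (s3 ^+ q)).
    by case: eqP => _; rewrite ?scaler0 // !scalerA (mulrC s3).
  + move=> m [Bm [w [Bw hw]]]; split=> //.
    exists (s1 ^+ q *: w); split=> [|i]; first exact: (submodZ _ hB).
    have := submodZ s1 hZ (hw i); rewrite scalerBr -kappaZ !scalerA.
    rewrite (mulrC (s1 ^+ q)).
    by case: eqP => _; rewrite ?scaler0 // !scalerA.
exists s'; split=> // m Bm; have [s1 [ns1 h1]] := one j m Bm.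
by have [_ ] : D s' m by apply: (hs' s1).
Qed.

(** If [z] multiplies [B] into [N], then so do, up to the fixed factor [s'],
    its coordinates over the q-th powers. So the ideal [I] of all such [z] lies,
    near [P], in the ideal generated by its q-th powers, and is trivial. *)
Lemma test_element : exists sigma, ~ inP sigma /\ forall N, submod N ->
  Z `<=` N -> (forall m, N m -> N (kappa m)) ->
  (exists2 d, ~ inP d & forall m, B m -> N (d *: m)) ->
  exists k, forall m, B m -> N (sigma ^+ k *: m).
Proof.
have [t [x [s [ix ns hx]]]] := frobenius_basis.
have [s' [ns' hdual]] := dual_basis ix ns hx.
exists ((s' * s) ^+ q); split; first by apply: notin_primeX; apply: notin_primeM.
move=> N hN ZN kN [d nd dB].
pose I : set R := [set a | forall m, B m -> N (a *: m)].
have hI : is_ideal I.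
  split=> [m _|a b ha hb m Bm|a b hb m Bm].
  - by rewrite scale0r; case: hN.
  - by rewrite scalerDl; apply: (opsubD hN); auto.
  - by rewrite -scalerA; apply: (submodZ _ hN); auto.
have PI : inP `<=` I by move=> a Pa m Bm; apply: ZN; apply: PB.
have coord z : I z -> exists c : 'I_t -> R, (forall j, I (s' * c j)) /\
    inP (s ^+ q * z - \sum_j c j ^+ q * x j).
  move=> Iz; have [c hc] := hx z; exists c; split=> // j m Bm.
  have [w [Bw hw]] := hdual j m Bm.
  have Nz : N (kappa ((s ^+ q * z) *: w)).
    by rewrite -scalerA kappaZ; apply: (submodZ _ hN); apply: kN; apply: Iz.
  have Nsum : N (\sum_i c i *: kappa (x i *: w)).
    have -> : \sum_i c i *: kappa (x i *: w) = kappa ((s ^+ q * z) *: w)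
        - kappa ((s ^+ q * z - \sum_i c i ^+ q * x i) *: w).
      rewrite -raddfB -scalerBl subKr scaler_suml raddf_sum.
      by apply: eq_bigr => i _; rewrite -scalerA kappaZ.
    case: (hN) => _ NB _; apply: NB => //.
    by apply: ZN; apply: kZ; apply: PB.
  have -> : (s' * c j) *: m = \sum_i c i *: kappa (x i *: w) -
      \sum_i c i *: (kappa (x i *: w) - (if i == j then s' *: m else 0)).
    rewrite -sumrB (bigD1 j) //= eqxx big1 ?addr0.
      by rewrite -scalerBr subKr scalerA mulrC.
    by move=> i /negbTE ->; rewrite subr0 subrr.
  case: (hN) => _ NB _; apply: NB => //.
  by apply: ZN; apply: (submod_comb _ _ hZ).
have [n [y [Iy yI]]] := noetherian_fg nR hI.
have sys i : exists A : 'I_n -> R, (forall j, I (A j)) /\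
    inP ((s' * s) ^+ q * y i - \sum_j A j * y j).
  have [c [Ic hc]] := coord _ (Iy i).
  have /choice [b hb] : forall j, exists b : 'I_n -> R,
      s' * c j = \sum_k b k * y k by move=> j; apply: yI.
  exists (fun k => \sum_j b j k * ((s' * c j) ^+ q.-1 * x j)).
  split=> [k|].
    apply: (ideal_sum hI) => j; apply: (idealM hI); apply: (ideal_mulr hI).
    case: (q) q_gt1 => [//|[//|q' _]] /=.
    by rewrite exprS; apply: (ideal_mulr hI).
  have -> : \sum_k (\sum_j b j k * ((s' * c j) ^+ q.-1 * x j)) * y k =
      s' ^+ q * \sum_j c j ^+ q * x j.
    under eq_bigr do rewrite mulr_suml.
    rewrite exchange_big mulr_sumr /=; apply: eq_bigr => j _.
    transitivity ((\sum_k b j k * y k) * ((s' * c j) ^+ q.-1 * x j)).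
      by rewrite mulr_suml; apply: eq_bigr => k _; rewrite mulrAC.
    rewrite -hb mulrA -exprS prednK ?(ltnW q_gt1) //.
    by rewrite exprMn_comm ?mulrA //; apply: mulrC.
  rewrite exprMn_comm; last exact: mulrC.
  by rewrite -mulrA -mulrBr; apply: (idealM (prime_ideal P)).
have /choice [A hA] := sys.
exists n; apply: (@nakayama_power R P I n y (\matrix_(i, j) A i j) _ d) => //.
- by move=> i j; rewrite mxE; case: (hA i).
- by move=> i; under eq_bigr do rewrite mxE; case: (hA i).
Qed.

End TestElement.
Hypothesis accM : macc [set: M].

Lemma iter_kappaB n : zmod_morphism (iter n kappa).
Proof. by elim: n => // n IH x y /=; rewrite IH raddfB. Qed.

Lemma iter_kappaZ n a m : iter n kappa (a ^+ (q ^ n) *: m) = a *: iter n kappa m.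
Proof.
elim: n a m => [|n IH] a m; first by rewrite expn0 expr1.
by rewrite !iterSr expnSr exprM kappaZ IH.
Qed.

Definition cartier_chain (N : nat -> set M) : Prop :=
  [/\ (forall n, submod (N n)), (forall n, N n.+1 `<=` N n),
      (forall n m, N n m -> N n (kappa m))
    & (forall n m, N n m -> exists2 m', N n m' & kappa m' = m)].

Lemma chain_dec (T : Type) (N : nat -> set T) :
  (forall n, N n.+1 `<=` N n) -> forall i n, (i <= n)%N -> N n `<=` N i.
Proof.
move=> h i n /subnK <-; elim: (n - i)%N => [|k IH] //.
by apply: subset_trans IH; apply: h.
Qed.

Section Generic.
Variables (P : Spec R) (c : R) (N : nat -> set M).
Local Notation inP := (prime_set P).
Hypotheses (hN : cartier_chain N) (nc : ~ inP c).
Hypothesis Pc : forall a, inP a -> forall n m, N 0%N m -> N n ((a * c) *: m).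

Let hS n : submod (N n). Proof. by case: hN. Qed.
Let Ndec n : N n.+1 `<=` N n. Proof. by case: hN. Qed.
Let Nk n m : N n m -> N n (kappa m). Proof. by case: hN => _ _ + _; apply. Qed.
Let Nonto n m : N n m -> exists2 m', N n m' & kappa m' = m.
Proof. by case: hN => _ _ _; apply. Qed.

Let Nstable n l m : N n m -> N n (iter l kappa m).
Proof. by move=> Nm; elim: l => //= l; apply: Nk. Qed.

Let Niter n l m : N n m -> exists2 m', N n m' & iter l kappa m' = m.
Proof.
elim: l m => [|l IH] m Nm; first by exists m.
have [m' Nm' <-] := Nonto Nm; have [m'' Nm'' <-] := IH m' Nm'.
by exists m''.
Qed.

(** The kernel of the map from [M] to the localization at [P] of its quotient by
    the intersection of the chain. *)
Definition torsion : set M :=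
  [set m | exists2 s, ~ inP s & forall n, N n (s *: m)].

Lemma torsion_submod : submod torsion.
Proof.
apply/submodP; split.
- exists 1; first exact: notin_prime1.
  by move=> n; rewrite scaler0; case: (hS n).
- move=> x y [s ns hs] [s' ns' hs']; exists (s * s'); first exact: notin_primeM.
  move=> n; rewrite scalerDr; apply: (opsubD (hS n)).
    by rewrite mulrC -scalerA; apply: (submodZ _ (hS n)).
  by rewrite -scalerA; apply: (submodZ _ (hS n)).
- move=> a x [s ns hs]; exists s => // n.
  by rewrite scalerA mulrC -scalerA; apply: (submodZ _ (hS n)).
Qed.

Lemma torsion_sat s m : ~ inP s -> torsion (s *: m) -> torsion m.
Proof.
move=> ns [s' ns' h]; exists (s' * s); first exact: notin_primeM.
by move=> n; rewrite -scalerA; apply: h.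
Qed.

Lemma torsion_kappa m : torsion m -> torsion (kappa m).
Proof.
move=> [s ns h]; exists s => // n; rewrite -kappaZ; apply: Nk.
rewrite -(prednK (ltnW q_gt1)) exprS mulrC -scalerA.
exact: (submodZ _ (hS n)).
Qed.

Lemma torsion_prime a m : inP a -> N 0%N m -> torsion (a *: m).
Proof.
move=> Pa Nm; exists c => // n; rewrite scalerA mulrC; exact: Pc.
Qed.

Lemma torsion_uniform : exists2 s, ~ inP s &
  forall m, torsion m -> forall n, N n (s *: m).
Proof.
have [|||s ns hs] := @acc_directed M (@scalings R M) _ R [set s | ~ inP s]
  (fun s => [set m | forall n, N n (s *: m)]) accM.
- by exists 1; apply: notin_prime1.
- move=> s ns; split=> //; apply/submodP; split=> [n|x y hx hy n|a x hx n].
  + by rewrite scaler0; case: (hS n).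
  + by rewrite scalerDr; apply: (opsubD (hS n)).
  + by rewrite scalerA mulrC -scalerA; apply: (submodZ _ (hS n)).
- move=> s s' ns ns'; exists (s * s'); split; first exact: notin_primeM.
  + by move=> m h n; rewrite mulrC -scalerA; apply: (submodZ _ (hS n)).
  + by move=> m h n; rewrite -scalerA; apply: (submodZ _ (hS n)).
by exists s => // m [s' ns' hm]; apply: (hs s').
Qed.

(** Modulo [torsion] the members of the chain localize at [P] to subspaces of a
    finite-dimensional vector space over the residue field; the index [i] is one
    for which the dimension is minimal. *)
Lemma rank_stable : exists i, forall n, exists2 d, ~ inP d &
  forall m, N i m -> N n (d *: m).
Proof.
have PB n a m : inP a -> N n m -> torsion (a *: m).
  by move=> Pa Nm; apply: torsion_prime => //; apply: chain_dec Nm.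
have macN n : macc (N n) by apply: acc_sub accM.
pose rk n r := exists (u : 'I_r -> M), [/\ (forall l, N n (u l)),
  indep P torsion u & forall m, N n m -> sat_span P torsion u m].
have rk_ex n : exists r, rk n r.
  have [r [u [s [Nu iu ns hs]]]] :=
    exists_basis torsion_submod (macN n) (hS n) (PB n).
  by exists r, u; split=> // m /hs h; exists s.
have [r [[i [u [Nu iu su]]] hmin]] : exists r, (exists n, rk n r) /\
    forall n r', rk n r' -> (r <= r')%N.
  have ex : exists r, `[< exists n, rk n r >].
    by have [r hr] := rk_ex 0%N; exists r; apply/asboolP; exists 0%N.
  case: (ex_minnP ex) => r /asboolP hr hmin; exists r; split=> // n r' hr'.
  by apply: hmin; apply/asboolP; exists n.
exists i => n; have [ni|/ltnW lin] := leqP n i.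
  exists 1; first exact: notin_prime1.
  by move=> m Nm; rewrite scale1r; apply: chain_dec Nm.
have [r' hr'] := rk_ex n; have rr' := hmin n r' hr'; case: hr' => v [Nv iv _].
have NinNi := chain_dec Ndec lin.
pose v' (l : 'I_r) := v (widen_ord rr' l).
have iv' : indep P torsion v' by apply: indep_comp iv => // l l' /(congr1 val) /= /val_inj.
have spn m : N i m -> sat_span P torsion v' m.
  move=> Nm; apply: (indep_span torsion_submod (u := u)) => //; last exact: su.
  - by move=> a j Pa; apply: PB (Nu j).
  - by move=> j; apply: su; apply: NinNi; apply: Nv.
have [s0 ns0 hs0] := torsion_uniform.
have [|||d nd hd] := @acc_directed M (@scalings R M) _ R [set s | ~ inP s]
  (fun s => [set m | N n (s *: m)]) accM.
- by exists 1; apply: notin_prime1.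
- move=> s ns; split=> //; apply/submodP; split=> [|x y hx hy|a x hx].
  + by rewrite /= scaler0; case: (hS n).
  + by rewrite /= scalerDr; apply: (opsubD (hS n)).
  + by rewrite /= scalerA mulrC -scalerA; apply: (submodZ _ (hS n)).
- move=> s s' ns ns'; exists (s * s'); split; first exact: notin_primeM.
  + by move=> m h /=; rewrite mulrC -scalerA; apply: (submodZ _ (hS n)).
  + by move=> m h /=; rewrite -scalerA; apply: (submodZ _ (hS n)).
exists d => // m /spn [s [ns [a ha]]]; apply: (hd (s0 * s)).
  exact: notin_primeM.
rewrite /= -scalerA -(subrK (\sum_l a l *: v' l) (s *: m)) scalerDr.
apply: (opsubD (hS n)); first exact: hs0.
apply: (submodZ _ (hS n)); apply: (submod_comb _ _ (hS n)) => l; exact: Nv.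
Qed.

(** Modulo its largest nilpotent part the Cartier module is nondegenerate at
    [P]; surjectivity of [kappa] makes the nilpotent part disappear again. *)
Lemma generic_stable : exists i s, ~ inP s /\
  forall n m, N i m -> N n (s *: m).
Proof.
have [i hi] := rank_stable; have [s0 ns0 hs0] := torsion_uniform.
have hT := torsion_submod.
pose W n : set M := [set v | forall a, torsion (iter n kappa (a *: v))].
have hW n : submod (W n).
  apply/submodP; split=> [a|x y hx hy a|b x hx a].
  - by rewrite scaler0 -(subrr 0) iter_kappaB subrr; case: hT.
  - rewrite scalerDr -[a *: y]opprK iter_kappaB -scaleNr.
    have -> : iter n kappa (- a *: y) = - iter n kappa (a *: y).
      by rewrite -[- a]sub0r scalerBl iter_kappaB scale0r -(subrr 0) iter_kappaB
        subrr sub0r.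
    by rewrite opprK; apply: (opsubD hT).
  - by rewrite scalerA; apply: hx.
have WS n : W n `<=` W n.+1.
  by move=> v hv a /=; apply: torsion_kappa; apply: hv.
have [//|n hn] := accM hW WS.
have W0 : torsion `<=` W n.
  move=> v Tv; apply: (chain_le WS (leq0n n)) => a /=.
  exact: (submodZ _ hT).
have kW m : W n m -> W n (kappa m).
  by move=> hm a; rewrite -kappaZ -iterSr; apply: torsion_kappa; apply: hm.
have satW s m : ~ inP s -> W n (s *: m) -> W n m.
  move=> ns hm a; apply: (torsion_sat ns); rewrite -iter_kappaZ scalerA mulrC.
  have := hm (a * s ^+ (q ^ n).-1).
  by rewrite scalerA -mulrA -exprSr prednK ?expn_gt0 ?(ltnW q_gt1).
have nondegW m : (forall a, W n (kappa (a *: m))) -> W n m.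
  move=> hm; apply: (hn n.+1) => a; rewrite iterSr.
  by have := hm a 1; rewrite scale1r.
have PW a m : inP a -> N i m -> W n (a *: m).
  by move=> Pa Nm; apply: W0; apply: torsion_prime => //; apply: chain_dec Nm.
have [sigma [ns hsigma]] := test_element (acc_sub (fun _ _ => I) accM) (hS i)
  (hW n) satW PW (@Nk i) kW nondegW.
exists i, (s0 * sigma); split; first exact: notin_primeM.
move=> j m Nm.
pose Q : set M := [set x | exists y z, [/\ N j y, W n z & x = y + z]].
have hQ : submod Q.
  apply/submodP; split.
  - exists 0, 0; rewrite addr0.
    by split=> //; [case: (hS j)|case: (hW n)].
  - move=> _ _ [y [z [Ny Wz ->]]] [y' [z' [Ny' Wz' ->]]].
    exists (y + y'), (z + z'); rewrite addrACA.
    by split=> //; [apply: (opsubD (hS j))|apply: (opsubD (hW n))].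
  - move=> a _ [y [z [Ny Wz ->]]]; exists (a *: y), (a *: z).
    by rewrite scalerDr; split=> //;
      [apply: (submodZ _ (hS j))|apply: (submodZ _ (hW n))].
have kQ x : Q x -> Q (kappa x).
  move=> [y [z [Ny Wz ->]]]; exists (kappa y), (kappa z).
  by rewrite raddfD; split=> //; [apply: Nk|apply: kW].
have WQ : W n `<=` Q.
  by move=> z Wz; exists 0, z; rewrite add0r; split=> //; case: (hS j).
have NQ : N j `<=` Q.
  by move=> y Ny; exists y, 0; rewrite addr0; split=> //; case: (hW n).
have [|k hk] := hsigma Q hQ WQ kQ.
  by have [d nd hd] := hi j; exists d => // x /hd/NQ.
have sQ x : N i x -> Q (sigma *: x).
  move=> Nx; have [y Ny <-] := Niter k Nx.
  rewrite -iter_kappaZ.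
  suff : Q (sigma ^+ (q ^ k) *: y).
    by elim: (k) (sigma ^+ _ *: y) => // l IH z /kQ/IH; rewrite -iterSr.
  rewrite -(subnK (ltnW (ltn_expl k q_gt1))) exprD -scalerA.
  by apply: (submodZ _ hQ); apply: hk.
have [y Ny <-] := Niter n Nm.
rewrite -scalerA -iter_kappaZ.
have [x [w [Nx Ww ->]]] : Q (sigma ^+ (q ^ n) *: y).
  rewrite -(prednK (_ : 0 < q ^ n)%N) ?expn_gt0 ?(ltnW q_gt1) //.
  rewrite exprSr -scalerA; apply: (submodZ _ hQ); exact: sQ.
rewrite -[w]opprK iter_kappaB scalerBr; have [_ NB _] := hS j; apply: NB.
  by apply: (submodZ _ (hS j)); apply: Nstable.
apply: hs0; have := opsubN (hW n) Ww => /(_ 1); by rewrite scale1r.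
Qed.

End Generic.

(** This is the unit ideal exactly when the chain is constant. *)
Definition conductor (N : nat -> set M) : set R :=
  [set a | forall n m, N 0%N m -> N n (a *: m)].

Lemma conductor_ideal N : cartier_chain N -> is_ideal (conductor N).
Proof.
case=> hS _ _ _; split=> [n m _|a b ha hb n m Nm|a b hb n m Nm].
- by rewrite scale0r; case: (hS n).
- by rewrite scalerDl; apply: (opsubD (hS n)); auto.
- by rewrite -scalerA; apply: (submodZ _ (hS n)); auto.
Qed.

(** If [a^q m'] is in [N n], then [a kappa m'] is, and every element of [N 0] is
    of the form [kappa m']. *)
Lemma conductor_radical N a : cartier_chain N ->
  conductor N (a * a) -> conductor N a.
Proof.
move=> [hS _ Nk Nonto] h n m Nm; have [m' Nm' <-] := Nonto 0%N m Nm.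
rewrite -kappaZ; apply: Nk.
case: (q) q_gt1 => [//|[//|q' _]]; rewrite !exprS mulrA mulrC -scalerA.
by apply: (submodZ _ (hS n)); apply: h.
Qed.

Lemma cartier_chain_shift N i : cartier_chain N ->
  cartier_chain (fun n => N (i + n)%N).
Proof.
move=> [hS Nd Nk No]; split=> [n|n|n m|n m]; first exact: hS.
- by rewrite addnS; apply: Nd.
- exact: Nk.
- exact: No.
Qed.

(** Noetherian induction on the conductor. A proper radical ideal has an
    associated prime [P], and stability at [P] enlarges the conductor. *)
Theorem cartier_chain_stationary N : cartier_chain N ->
  exists n, forall m, N n `<=` N m.
Proof.
move=> hN0; apply: contrapT => nN0.
have [||_ [{N hN0 nN0}N [hN nN ->]] hmax] := @ideal_max R
  [set J | exists N, [/\ cartier_chain N, ~ (exists n, forall m, N n `<=` N m)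
     & J = conductor N]] nR.
- by move=> _ [N' [hN' _ ->]]; apply: conductor_ideal.
- by exists (conductor N), N.
have hJ := conductor_ideal hN.
pose colon (c : R) : set R := [set a | conductor N (a * c)].
have colon_ideal c : is_ideal (colon c).
  split=> [|a b|a b]; rewrite /colon /=.
  - by rewrite mul0r; case: hJ.
  - by rewrite mulrDl; apply: (idealD hJ).
  - by rewrite -mulrA; apply: (idealM hJ).
have [||_ [c nc <-] cmax] := @ideal_max R [set colon c | c in ~` conductor N] nR.
- by move=> _ [c _ <-].
- exists (colon 1), 1 => //= h1; apply: nN; exists 0%N => n m Nm.
  by rewrite -(scale1r m); apply: h1.
have c1 : ~ colon c 1 by rewrite /colon /= mul1r.
have cprime a b : colon c (a * b) -> colon c a \/ colon c b.
  move=> hab; have [hb|nb] := pselect (colon c b); [by right|left].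
  apply: (cmax (colon (b * c))).
  - by exists (b * c).
  - by move=> x; rewrite /colon /= mulrCA; apply: (idealM hJ).
  - by rewrite /colon /= mulrA.
pose P := MkSpec (colon_ideal c) c1 cprime.
have [//|a Pa n m Nm|i [s [ns hs]]] := @generic_stable P c N hN.
- by move=> /conductor_radical h; apply: nc; apply: h.
- exact: Pa.
have sub : conductor N `<=` conductor (fun n => N (i + n)%N).
  move=> a ha n m Nm; apply: ha; case: hN => _ Nd _ _.
  exact: (chain_dec Nd (leq0n (i + 0))).
apply: ns; apply: (ideal_mulr hJ).
apply: (hmax (conductor (fun n => N (i + n)%N))) => //; last first.
  by move=> n m Nm; apply: hs; rewrite addn0 in Nm.
exists (fun n => N (i + n)%N); split=> //; first exact: cartier_chain_shift.
move=> [n hn]; apply: nN; exists (i + n)%N => m x /(hn m).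
by case: hN => _ Nd _ _; apply: (chain_dec Nd (leq_addl i m)).
Qed.

End CartierChain.

(** * Affine open sets *)

Section Opens.
Variable X : topologicalType.

Lemma opens_eq (U V : opens X) : oset U = oset V -> U = V.
Proof.
by case: U V => [U hU] [V hV] /= UV; subst V; congr Opens; apply: Prop_irrelevance.
Qed.

Definition opens_meet (U V : opens X) : opens X :=
  Opens (openI (oset_open U) (oset_open V)).

End Opens.

Section Nonvanishing.
Variable X : ringed_space.
Local Notation O := (ssheaf X).

Lemma sres_comp (U V W : opens X) (s : V `<=` U) (s' : W `<=` V)
  (s'' : W `<=` U) a : sres s' (sres s a) = sres s'' a.
Proof. by case: (ssheaf_presheaf X) => _; apply. Qed.

(** The nonvanishing locus in terms of the structure sheaf alone, hence the
    same in every affine chart. *)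
Definition nv (U : opens X) (h : O U) : set X :=
  [set x | exists (V : opens X) (s : V `<=` U), oset V x /\
    exists c, c * sres s h = 1].

Lemma nv_sub (U : opens X) (h : O U) : nv h `<=` U.
Proof. by move=> x [V [s [Vx _]]]; apply: s. Qed.

Lemma nv_open (U : opens X) (h : O U) : open (nv h).
Proof.
have -> : nv h = \bigcup_(V in [set V : opens X |
    exists (s : V `<=` U) c, c * sres s h = 1]) oset V.
  apply/seteqP; split=> [x [V [s [Vx hc]]]|x [V [s hc] Vx]].
  - by exists V => //; exists s.
  - by exists V, s.
by apply: bigcup_open => V _; apply: oset_open.
Qed.

Lemma nv1 (U : opens X) : nv (1 : O U) = U.
Proof.
apply/seteqP; split; first exact: nv_sub.
by move=> x Ux; exists U, (@subset_refl _ _); split=> //; exists 1; rewrite mul1r rmorph1.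
Qed.

Lemma nv_mulP (U : opens X) (a b : O U) x : nv (a * b) x <-> nv a x /\ nv b x.
Proof.
split=> [[V [s [Vx [c cab]]]]|[[V [s [Vx [c ca]]]] [V' [s' [Vx' [c' cb]]]]]].
  rewrite rmorphM in cab; split; exists V, s; split=> //.
    by exists (c * sres s b); rewrite mulrAC -mulrA.
  by exists (c * sres s a); rewrite -mulrA.
have t : opens_meet V V' `<=` V by move=> y [].
have t' : opens_meet V V' `<=` V' by move=> y [].
exists (opens_meet V V'), (subset_trans t s); split=> //.
exists (sres t c * sres t' c'); rewrite rmorphM mulrACA.
rewrite -(sres_comp s t) -rmorphM ca rmorph1 mul1r.
by rewrite -(sres_comp s' t') -rmorphM cb rmorph1.
Qed.

Lemma nv_exp (U : opens X) (a : O U) n x : nv a x -> nv (a ^+ n) x.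
Proof.
move=> ha; elim: n => [|n IH]; first by rewrite expr0 nv1; apply: nv_sub ha.
by rewrite exprS; apply/nv_mulP.
Qed.

Lemma nv_res (U V : opens X) (s : V `<=` U) (h : O U) :
  nv (sres s h) = nv h `&` V.
Proof.
apply/seteqP; split=> [x hx|x [[W [t [Wx [c ch]]]] Vx]].
  split; last exact: nv_sub hx.
  case: hx => W [t [Wx [c ch]]]; exists W, (subset_trans t s).
  by split=> //; exists c; rewrite -(sres_comp s t).
have t1 : opens_meet V W `<=` V by move=> y [].
have t2 : opens_meet V W `<=` W by move=> y [].
exists (opens_meet V W), t1; split=> //; exists (sres t2 c).
rewrite (sres_comp s t1 (subset_trans t2 t)) -(sres_comp t t2).
by rewrite -rmorphM ch rmorph1.
Qed.

(** The properties of affine open sets on which everything below depends: the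
    nonvanishing loci form a basis, sections over them are fractions, and the
    stalks are local rings. *)
Definition affine_like (U : opens X) : Prop :=
  [/\ (forall x (V : opens X), oset U x -> oset V x -> exists h : O U,
         nv h x /\ nv h `<=` V),
      (forall (h : O U) (V : opens X) (s : V `<=` U), oset V = nv h ->
         is_localization (powers h) (sres s)),
      (forall x, ~ nv (0 : O U) x)
    & (forall (a b : O U) x, nv (a + b) x -> nv a x \/ nv b x)].

(** The radical of an ideal is determined by the points where it vanishes. *)
Definition nullstellensatz (U : opens X) : Prop :=
  forall (I : set (O U)) (h : O U), is_ideal I ->
    (forall x, nv h x -> exists2 b, I b & nv b x) -> exists n, I (h ^+ n).

(** Open sets with these properties are quasi-compact, in the form of an
    induction principle: the [h] whose locus has a property stable under unions
    and subsets form an ideal. *)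
Lemma affine_induction (U : opens X) (Q : set X -> Prop) :
  affine_like U -> nullstellensatz U -> Q set0 ->
  (forall A B, A `<=` B -> Q B -> Q A) ->
  (forall A B, Q A -> Q B -> Q (A `|` B)) ->
  (forall x, oset U x -> exists V : opens X, oset V x /\ Q V) -> Q U.
Proof.
move=> [basis _ nv0 nvD] null Q0 Qm QU Qloc.
have [|x|n] := null [set h | Q (nv h)] 1.
- split=> [|a b Qa Qb|a b Qb].
  + by apply: Qm Q0 => x /nv0.
  + by apply: Qm (QU _ _ Qa Qb) => x /nvD.
  + by apply: Qm Qb => x /nv_mulP [].
- move=> /nv_sub Ux; have [V [Vx QV]] := Qloc x Ux.
  by have [h [hx hV]] := basis x V Ux Vx; exists h => //; apply: Qm QV.
- by rewrite /= expr1n nv1.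
Qed.

Lemma localization_unit (A B : comPzRingType) (h : A) (g : {rmorphism A -> B}) :
  is_localization (powers h) g -> exists v, v * g h = 1.
Proof. by case=> + _ _; apply; exists 1%N; rewrite // expr1. Qed.

(** ** Affine charts *)

Section Chart.
Variables (U : opens X) (c : affine_chart U).

Lemma spec_open_basic (W : set (Spec (O U))) q : open W -> W q ->
  exists g, ~ prime_set q g /\ basic_open g `<=` W.
Proof.
move=> [S ->] /existsNP [g /not_implyP [Sg qg]]; exists g; split=> //.
by move=> q' /= q'g h; apply: q'g; apply: h.
Qed.

(** The inverse of [h] near a point is a fraction [a / g^n] on a smaller basic
    open set, so that [h] divides a power of [g] there. *)
Lemma chart_nv (q : Spec (O U)) (h : O U) : nv h (c q) <-> ~ prime_set q h.
Proof.
split=> [[V [s [Vq [u uh]]]] qh|qh]; last first.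
  exists (chart_basic c h), (@chart_basic_sub X U c h); split; first by exists q.
  exact: (localization_unit (@chart_localization X U c h _ (@chart_basic_sub X U c h) erefl)).
have oV : open (c @^-1` V).
  by move/continuousP: (@chart_continuous X U c) => /(_ _ (oset_open V)).
have [g [qg gV]] := spec_open_basic oV Vq.
have [_ frac tors] := @chart_localization X U c g _
  (@chart_basic_sub X U c g) erefl.
have s' : chart_basic c g `<=` V by move=> _ [q' q'g <-]; apply: gV.
have [a [_ [[n _ <-] ua]]] := frac (sres s' u).
have [|_ [k _ <-] hk] := tors (a * h - g ^+ n).
  have uh' : sres s' u * sres (@chart_basic_sub X U c g) h = 1.
    by rewrite -(sres_comp s s') -rmorphM uh rmorph1.
  by rewrite rmorphB rmorphM -ua mulrAC uh' mul1r subrr.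
have hq := prime_ideal q.
have : prime_set q (g ^+ k * g ^+ n).
  have -> : g ^+ k * g ^+ n = g ^+ k * a * h - g ^+ k * (a * h - g ^+ n) by ring.
  by rewrite hk subr0; apply: (idealM hq).
by move=> /(prime_prime (s := q)) []; apply: notin_primeX.
Qed.

Lemma chart_surj x : oset U x -> exists q, c q = x.
Proof. by rewrite -(chart_range c) => -[q _ <-]; exists q. Qed.

Lemma chart_basic_nv h : oset (chart_basic c h) = nv h.
Proof.
apply/seteqP; split=> [_ [q qh <-]|x hx]; first exact/chart_nv.
have [q qx] := chart_surj (nv_sub hx); subst x; exists q => //=.
exact/chart_nv.
Qed.

Lemma chart_affine_like : affine_like U.
Proof.
split.
- move=> x V /chart_surj [q <-] Vq.
  have oV : open (c @^-1` V).
    by move/continuousP: (@chart_continuous X U c) => /(_ _ (oset_open V)).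
  have [g [qg gV]] := spec_open_basic oV Vq; exists g; split; first exact/chart_nv.
  by rewrite -chart_basic_nv => _ [q' q'g <-]; apply: gV.
- by move=> h V s Vh; apply: (@chart_localization X U c); rewrite Vh -chart_basic_nv.
- move=> x x0; have [q qx] := chart_surj (nv_sub x0); subst x.
  by move/chart_nv: x0; apply; case: (prime_ideal q).
- move=> a b x hx; have [q qx] := chart_surj (nv_sub hx); subst x.
  move/chart_nv: hx => nab; apply: contrapT => /not_orP [na nb]; apply: nab.
  apply: (idealD (prime_ideal q)); apply: contrapT => h;
    [apply: na | apply: nb]; exact/chart_nv.
Qed.

Lemma chart_nullstellensatz : noetherian (O U) -> nullstellensatz U.
Proof.
move=> nO I h hI hx; apply: contrapT => nh.
have [|||q [Iq nq]] := @exists_prime (O U)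
  [set J | exists n, J (h ^+ n)] I nO hI nh.
- by exists 0%N.
- by move=> J K _ _ [n Jn] JK; exists n; apply: JK.
- move=> J K L _ _ _ [n Jn] [m Km] JKL; exists (n + m)%N.
  by rewrite exprD; apply: JKL.
have [|b Ib] := hx (c q).
  by apply/chart_nv => qh; apply: nq; exists 1%N.
by move/chart_nv; apply; apply: Iq.
Qed.

End Chart.

(** ** Basic open subsets of affine open sets *)

Section Basic.
Variables (U : opens X) (w : O U) (D : opens X) (s : D `<=` U).
Hypotheses (hU : affine_like U) (Dw : oset D = nv w).

Lemma basic_unit : exists v, v * sres s w = 1.
Proof. by case: hU => _ loc _ _; apply: localization_unit (loc _ _ _ Dw). Qed.

Lemma basic_fraction (a : O D) : exists (b : O U) k, a * sres s w ^+ k = sres s b.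
Proof.
case: hU => _ loc _ _; have [_ frac _] := loc w D s Dw.
by have [b [_ [[k _ <-] h]]] := frac a; exists b, k; rewrite -h rmorphXn.
Qed.

Lemma nv_fraction (a : O D) (b : O U) k :
  a * sres s w ^+ k = sres s b -> nv a = nv (w * b).
Proof.
move=> ab; have aw : nv (a * sres s w ^+ k) = nv a.
  apply/seteqP; split=> x; first by case/nv_mulP.
  move=> ax; apply/nv_mulP; split=> //; apply: nv_exp.
  by rewrite nv_res -Dw; split; apply: nv_sub ax.
rewrite -aw ab nv_res Dw; apply/seteqP; split=> x.
  by move=> [bx wx]; apply/nv_mulP.
by move=> /nv_mulP [wx bx].
Qed.

Lemma basic_affine_like : affine_like D.
Proof.
case: (hU) => basis loc nv0 nvD; have [v vw] := basic_unit.
have vwk k : v ^+ k * sres s w ^+ k = 1.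
  by rewrite -exprMn_comm ?vw ?expr1n //; apply: mulrC.
split.
- move=> x V Dx Vx.
  have [h [hx hV]] := basis x (opens_meet V D) (s Dx) (conj Vx Dx).
  exists (sres s h); rewrite nv_res; split; first by split.
  by move=> y [/hV []].
- move=> a V t Va; have [b [k ab]] := basic_fraction a.
  have wb : sres s (w * b) = a * sres s w ^+ k.+1.
    by rewrite rmorphM -ab exprS mulrCA.
  have [unitV frac tors] := loc (w * b) V (subset_trans t s)
    (etrans Va (nv_fraction ab)).
  have resE z : sres (subset_trans t s) z = sres t (sres s z).
    by rewrite -(sres_comp s t).
  split.
  + move=> _ [n _ <-]; have [|u] := unitV ((w * b) ^+ n); first by exists n.
    rewrite resE rmorphXn wb exprMn_comm; last exact: mulrC.
    rewrite rmorphM => hu.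
    by exists (u * sres t ((sres s w ^+ k.+1) ^+ n)); rewrite -hu mulrA mulrAC.
  + move=> z; have [y [_ [[n _ <-] zy]]] := frac z.
    exists (v ^+ (k.+1 * n) * sres s y), (a ^+ n); split; first by exists n.
    rewrite resE rmorphXn wb resE exprMn_comm in zy; last exact: mulrC.
    rewrite rmorphM in zy.
    rewrite [RHS]rmorphM -zy mulrCA; congr (_ * _).
    rewrite [RHS]mulrCA -rmorphM -exprM vwk rmorph1 mulr1 //.
  + move=> z z0; have [y [m zy]] := basic_fraction z.
    have [|_ [l _ <-] hl] := tors y.
      by rewrite resE -zy rmorphM z0 mul0r.
    exists (a ^+ l); first by exists l.
    have /(congr1 (sres s)) := hl; rewrite rmorphM rmorphXn wb -zy rmorph0.
    rewrite exprMn_comm -?exprM; last exact: mulrC.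
    move=> /(congr1 ( *%R (v ^+ (k.+1 * l) * v ^+ m))); rewrite mulr0.
    have -> : v ^+ (k.+1 * l) * v ^+ m * (a ^+ l * sres s w ^+ (k.+1 * l) *
      (z * sres s w ^+ m)) = (v ^+ (k.+1 * l) * sres s w ^+ (k.+1 * l)) *
      (v ^+ m * sres s w ^+ m) * (a ^+ l * z) by ring.
    by rewrite !vwk !mul1r.
- by move=> x; rewrite -(rmorph0 (sres s)) nv_res => -[h _]; exact: nv0 h.
- move=> a b x; have [a' [k ka]] := basic_fraction a.
  have [b' [l lb]] := basic_fraction b.
  have ka' : a * sres s w ^+ (k + l) = sres s (a' * w ^+ l).
    by rewrite exprD mulrA ka rmorphM rmorphXn.
  have lb' : b * sres s w ^+ (k + l) = sres s (b' * w ^+ k).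
    by rewrite addnC exprD mulrA lb rmorphM rmorphXn.
  have ab : (a + b) * sres s w ^+ (k + l) = sres s (a' * w ^+ l + b' * w ^+ k).
    by rewrite mulrDl ka' lb' rmorphD.
  rewrite (nv_fraction ab) (nv_fraction ka') (nv_fraction lb') => /nv_mulP [wx].
  by move=> /nvD [h|h]; [left|right]; apply/nv_mulP.
Qed.

Lemma basic_nullstellensatz : nullstellensatz U -> nullstellensatz D.
Proof.
move=> null I h hI hx; have [v vw] := basic_unit.
have [h' [k hh']] := basic_fraction h.
have [||n hn] := null [set z | I (sres s z)] (w * h').
- split=> [|a b Ia Ib|a b Ib] /=.
  + by rewrite rmorph0; case: hI.
  + by rewrite rmorphD; apply: (idealD hI).
  + by rewrite rmorphM; apply: (idealM hI).
- move=> x; rewrite -(nv_fraction hh') => /hx [b Ib bx].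
  have [b' [l bb']] := basic_fraction b; exists b'.
    by rewrite /= -bb'; apply: (ideal_mulr hI).
  by move: bx; rewrite (nv_fraction bb') => /nv_mulP [].
exists n; have -> : h ^+ n = v ^+ (k.+1 * n) * sres s ((w * h') ^+ n).
  rewrite rmorphXn rmorphM -hh' mulrCA -exprS exprMn_comm -?exprM; last exact: mulrC.
  by rewrite mulrCA -exprMn_comm ?vw ?expr1n ?mulr1 //; apply: mulrC.
exact: (idealM hI).
Qed.

End Basic.

(** Small enough basic open sets of two affine open sets coincide. *)
Lemma common_basic_open (U U' V : opens X) x : affine_like U -> affine_like U' ->
  oset U x -> oset U' x -> oset V x ->
  exists (D : opens X) (w : O U) (w' : O U'),
    [/\ oset D x, D `<=` V, oset D = nv w & oset D = nv w'].
Proof.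
move=> hU hU' Ux Ux' Vx; have [basis _ _ _] := hU.
have [w0 [w0x w0V]] := basis x (opens_meet V U') Ux (conj Vx Ux').
pose W := Opens (nv_open w0).
have [basis' _ _ _] := hU'; have [w' [w'x w'W]] := basis' x W Ux' w0x.
have s : W `<=` U by apply: nv_sub.
have s' : W `<=` U' by move=> y /w0V [].
have [b [k hb]] := basic_fraction s hU (erefl : oset W = nv w0) (sres s' w').
have E : nv w' = nv (w0 * b).
  rewrite -(nv_fraction (s := s) (erefl : oset W = nv w0) hb) nv_res.
  by apply/seteqP; split=> y; [move=> hy; split=> //; apply: w'W|case].
exists (Opens (nv_open w')), (w0 * b), w'; split=> //.
by move=> y /w'W /w0V [].
Qed.

End Nonvanishing.

(** * Quasi-coherent submodules *)

Section QuasiCoherent.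
Variables (X : scheme) (M : omodule X).
Local Notation O := (ssheaf X).
Implicit Types G : forall U : opens X, set (M U).

Lemma mres_comp (U V W : opens X) (s : V `<=` U) (s' : W `<=` V)
  (s'' : W `<=` U) (m : M U) : mres s' (mres s m) = mres s'' m.
Proof. by case: (@msec_presheaf X M) => _; apply. Qed.

(** For [G = M] this and the next condition say that restriction from [U] to the
    nonvanishing locus of [h] is localization at [h]; for a submodule the
    second condition is inherited from [M]. *)
Definition extends G (U : opens X) : Prop :=
  forall (h : O U) (V : opens X) (s : V `<=` U), oset V = nv h ->
  forall y : M V, G V y -> exists n (m : M U), G U m /\
    sres s h ^+ n *: y = mres s m.

Definition torsion_on (U : opens X) : Prop :=
  forall (h : O U) (V : opens X) (s : V `<=` U), oset V = nv h ->
  forall m : M U, mres s m = 0 -> exists n, h ^+ n *: m = 0.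

Definition restricts G : Prop :=
  [/\ (forall U a m n, G U m -> G U n -> G U (a *: m + n)), (forall U, G U 0)
    & (forall (U V : opens X) (h : V `<=` U) m, G U m -> G V (mres h m))].

Lemma restrictsZ G U a m : restricts G -> G U m -> G U (a *: m).
Proof. by case=> hD h0 _ Gm; rewrite -[_ *: _]addr0; apply: hD. Qed.

Lemma submodule_restricts G : is_submodule G -> restricts G.
Proof. by case. Qed.

Lemma restrictsT : restricts (fun U => [set: M U]).
Proof. by []. Qed.

Section Basic.
Variables (U : opens X) (w : O U) (D : opens X) (s : D `<=` U).
Hypotheses (hU : affine_like U) (Dw : oset D = nv w).

Lemma basic_extends G : restricts G -> extends G U -> extends G D.
Proof.
move=> hG extU a V t Va y Gy; have [b [k ab]] := basic_fraction s hU Dw a.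
have [v vw] := basic_unit s hU Dw.
have wb : sres s (w * b) = a * sres s w ^+ k.+1.
  by rewrite rmorphM -ab exprS mulrCA.
have [n [m [Gm hm]]] := extU (w * b) V (subset_trans t s)
  (etrans Va (nv_fraction Dw ab)) y Gy.
exists n, (v ^+ (k.+1 * n) *: mres s m); split.
  by apply: restrictsZ => //; case: hG => _ _; apply.
rewrite mresZ (mres_comp s t (subset_trans t s)) -hm -(sres_comp s t) wb.
rewrite scalerA -!(rmorphXn (sres t)) -rmorphM; congr (sres t _ *: _).
rewrite exprMn_comm -?exprM; last exact: mulrC.
by rewrite mulrCA -exprMn_comm ?vw ?expr1n ?mulr1 //; apply: mulrC.
Qed.

Lemma basic_torsion : extends (fun U => [set: M U]) U -> torsion_on U ->
  torsion_on D.
Proof.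
move=> extU torU a V t Va m m0; have [b [k ab]] := basic_fraction s hU Dw a.
have [v vw] := basic_unit s hU Dw.
have wb : sres s (w * b) = a * sres s w ^+ k.+1.
  by rewrite rmorphM -ab exprS mulrCA.
have [j [m' [_ hm]]] := extU w D s Dw m I.
have [|n hn] := torU (w * b) V (subset_trans t s)
    (etrans Va (nv_fraction Dw ab)) m'.
  by rewrite -(mres_comp s t) -hm mresZ m0 scaler0.
exists n; have /(congr1 (mres s)) := hn.
rewrite mresZ rmorphXn wb raddf0 -hm scalerA.
move=> /(congr1 ( *:%R (v ^+ (k.+1 * n) * v ^+ j))); rewrite scaler0 scalerA.
rewrite exprMn_comm -?exprM; last exact: mulrC.
have -> : v ^+ (k.+1 * n) * v ^+ j * (a ^+ n * sres s w ^+ (k.+1 * n) *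
    sres s w ^+ j) = (v ^+ (k.+1 * n) * sres s w ^+ (k.+1 * n)) *
    (v ^+ j * sres s w ^+ j) * a ^+ n by ring.
by rewrite -!exprMn_comm ?vw ?expr1n ?mul1r //; apply: mulrC.
Qed.

End Basic.

(** A power of [h] that works near one point is found in an affine open set on
    which [G] is already known to be quasi-coherent; as [D] is quasi-compact, one
    exponent works everywhere on [D]. *)
Lemma extends_local G (D : opens X) : is_submodule G -> affine_like D ->
  nullstellensatz D -> extends (fun U => [set: M U]) D -> torsion_on D ->
  (forall x, oset D x -> exists U : opens X,
     [/\ oset U x, affine_like U & extends G U]) ->
  extends G D.
Proof.
move=> hG affD nullD extD torD locG h V s Vh y Gy.
have rG := submodule_restricts hG.
have [n [m [_ hm]]] := extD h V s Vh y I.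
pose Q (A : set X) := exists N, forall x, A x -> oset D x ->
  exists (W : opens X) (t : W `<=` D), oset W x /\ G W (mres t (h ^+ N *: m)).
have Qle N N' x : (N <= N')%N ->
  (exists (W : opens X) (t : W `<=` D), oset W x /\ G W (mres t (h ^+ N *: m))) ->
  exists (W : opens X) (t : W `<=` D), oset W x /\ G W (mres t (h ^+ N' *: m)).
  move=> NN' [W [t [Wx Gm]]]; exists W, t; split=> //.
  by rewrite -(subnK NN') exprD -scalerA mresZ; apply: restrictsZ.
have [N hN] : Q D.
  apply: affine_induction => //.
  - by exists 0%N.
  - by move=> A B AB [N hN]; exists N => x /AB; apply: hN.
  - move=> A B [N hN] [N' hN']; exists (maxn N N') => x [Ax|Bx] Dx.
      exact: Qle (leq_maxl _ _) (hN x Ax Dx).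
    exact: Qle (leq_maxr _ _) (hN' x Bx Dx).
  - move=> x Dx; have [U [Ux affU extU]] := locG x Dx.
    have [E [w [w' [Ex ED Ew Ew']]]] := common_basic_open affD affU Dx Ux Dx.
    have EU : E `<=` U by rewrite Ew'; apply: nv_sub.
    have extE := basic_extends EU affU Ew' rG extU.
    have torE := basic_torsion ED affD Ew extD torD.
    pose VE := opens_meet V E.
    have tV : VE `<=` V by move=> z [].
    have tE : VE `<=` E by move=> z [].
    have VEh : oset VE = nv (sres ED h) by rewrite nv_res -Vh.
    have [k [g [Gg hg]]] := extE (sres ED h) VE tE VEh (mres tV y)
      (let: And3 _ _ r := rG in r _ _ tV y Gy).
    have tD := subset_trans tE ED.
    have [|l hl] := torE (sres ED h) VE tE VEh
        (sres ED h ^+ k *: mres ED m - sres ED h ^+ n *: g).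
      rewrite raddfB !mresZ (mres_comp ED tE tD) -hg !rmorphXn.
      rewrite -(mres_comp s tV) -hm mresZ rmorphXn.
      rewrite !(sres_comp ED tE tD) !(sres_comp s tV tD).
      by rewrite !scalerA mulrC subrr.
    exists E; split=> //; exists (l + k)%N => z Ez _; exists E, ED; split=> //.
    move/eqP: hl; rewrite scalerBr subr_eq0 !scalerA -exprD => /eqP hl.
    by rewrite mresZ rmorphXn hl; apply: restrictsZ.
exists (N + n)%N, (h ^+ N *: m); split.
  by case: hG => _ _ _; apply => x Dx; apply: hN.
by rewrite mresZ -hm scalerA rmorphXn -exprD.
Qed.

Lemma coherent_sub_affine G x : coherent_sub G ->
  exists U : opens X, [/\ oset U x, affine_like U & extends G U].
Proof.
move=> /(_ x) [U [c [Ux _ ext _]]]; exists U; split=> //.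
  exact: chart_affine_like c.
move=> h V s Vh y Gy.
have E : V = chart_basic c h by apply: opens_eq; rewrite Vh chart_basic_nv.
subst V; have [n [m [Gm hm]]] := ext h y Gy; exists n, m; split=> //.
by rewrite -rmorphXn (Prop_irrelevance s (@chart_basic_sub X U c h)).
Qed.

Lemma coherent_affine x : coherent M ->
  exists U : opens X, [/\ oset U x, affine_like U,
    extends (fun U => [set: M U]) U, torsion_on U
    & exists n (g : 'I_n -> M U), forall m, exists a : 'I_n -> O U,
        m = \sum_i a i *: g i].
Proof.
move=> /(_ x) [U [c [Ux [n [g [_ hg]]] ext tor]]]; exists U; split=> //.
- exact: chart_affine_like c.
- move=> h V s Vh y Gy.
  have E : V = chart_basic c h by apply: opens_eq; rewrite Vh chart_basic_nv.
  subst V; have [k [m [Gm hm]]] := ext h y Gy; exists k, m; split=> //.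
  by rewrite -rmorphXn (Prop_irrelevance s (@chart_basic_sub X U c h)).
- move=> h V s Vh m m0.
  have E : V = chart_basic c h by apply: opens_eq; rewrite Vh chart_basic_nv.
  subst V; apply: (tor h m I).
  by rewrite -m0 (Prop_irrelevance s (@chart_basic_sub X U c h)).
- by exists n, g => m; apply: hg.
Qed.

Lemma basic_generated (U D : opens X) (w : O U) (s : D `<=` U) n
    (g : 'I_n -> M U) : affine_like U -> oset D = nv w ->
  extends (fun U => [set: M U]) U ->
  (forall m, exists a : 'I_n -> O U, m = \sum_i a i *: g i) ->
  forall m : M D, exists a : 'I_n -> O D, m = \sum_i a i *: mres s (g i).
Proof.
move=> hU Dw ext hg y; have [v vw] := basic_unit s hU Dw.
have [k [m [_ hm]]] := ext w D s Dw y I; have [a ma] := hg m.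
exists (fun i => v ^+ k * sres s (a i)).
have -> : y = v ^+ k *: mres s m.
  by rewrite -hm scalerA -exprMn_comm ?vw ?expr1n ?scale1r //; apply: mulrC.
rewrite ma raddf_sum scaler_sumr; apply: eq_bigr => i _.
by rewrite mresZ scalerA.
Qed.

End QuasiCoherent.

(** [D] is a basic open subset both of a chart of [X] given by a geometric
    algebra and of a chart on which [M] is coherent. The former makes the ring
    of sections noetherian and the latter makes the module finitely generated. *)
Lemma good_neighbourhood (p : nat) (k : fieldType) (hp : p \in [pchar k])
  (hk : perfect_field p k) (X : scheme)
  (f : {rmorphism k -> ssheaf X (opens_top X)}) (hX : geometric_scheme f)
  (L : omodule X) (hL : line_bundle L) (M : omodule X) (hM : coherent M) (x : X) :
  exists (D : opens X) (l : L D),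
    [/\ oset D x, affine_like D /\ nullstellensatz D,
        (forall (V : opens X) (s : V `<=` D),
            bijective (fun a : ssheaf X V => a *: mres s l)),
        extends (fun U => [set: M U]) D /\ torsion_on M D
      & [/\ noetherian (ssheaf X D), ffinite p (ssheaf X D)
          & macc [set: M D]]].
Proof.
have [n [U [cover charts geom]]] := hX.
have [i _ Ux] := cover x I; have [c] := charts i.
have top : U i `<=` opens_top X by [].
have gU := geom i top.
have [pU nU fU] := geometric_algebra_noetherian_ffinite hp hk gU.
have affU := chart_affine_like c; have nullU := chart_nullstellensatz c nU.
have [U' [U'x affU' ext' tor' [r [g hg]]]] := coherent_affine x hM.
have [V [l [Vx hl]]] := hL x.
have [D [w [w' [Dx DV Dw Dw']]]] := common_basic_open affU affU' Ux U'x Vx.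
have DU : D `<=` U i by rewrite Dw; apply: nv_sub.
have DU' : D `<=` U' by rewrite Dw'; apply: nv_sub.
have locD : is_localization (powers w) (sres DU).
  by case: affU => _ loc _ _; apply: loc.
have powS : mult_closed (powers w).
  split; first by exists 0%N.
  by move=> _ _ [a _ <-] [b _ <-]; exists (a + b)%N; rewrite // exprD.
have [_ nD fD] := geometric_algebra_noetherian_ffinite hp hk
  (geometric_localization gU powS locD).
exists D, (mres DV l); split=> //.
- split; first exact: basic_affine_like DU affU Dw.
  exact: basic_nullstellensatz DU affU Dw nullU.
- move=> W s; have := hl W (subset_trans s DV).
  by rewrite -(mres_comp DV s).
- split; first exact: (basic_extends DU' affU' Dw' (restrictsT M) ext').
  exact: (basic_torsion DU' affU' Dw' ext' tor').
- split=> //; apply: (fg_macc (g := fun i => mres DU' (g i)) nD) => m _.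
  exact: (basic_generated DU' affU' Dw' ext' hg m).
Qed.

Lemma ffinite_exp (p : nat) (A : comPzRingType) (e : nat) :
  prime p -> p%:R = 0 :> A -> ffinite p A -> ffinite (p ^ e) A.
Proof.
move=> p_prime pA fA; elim: e => [|e [T [x hx]]].
  exists unit, (fun=> 1) => a; exists (fun=> a).
  by rewrite (big_pred1 tt) ?expn0 ?expr1 ?mulr1 // => -[].
have [S [y hy]] := fA; exists (S * T)%type, (fun st => x st.2 ^+ p * y st.1) => a.
have [b ->] := hy a.
have /choice [d hd] : forall t, exists d : T -> A,
    b t = \sum_u d u ^+ (p ^ e) * x u by move=> t; apply: hx.
have sumX (F : T -> A) : (\sum_t F t) ^+ p = \sum_t F t ^+ p.
  apply: (big_morph (fun a => a ^+ p) (exprDp p_prime pA)).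
  by rewrite expr0n eqn0Ngt prime_gt0.
exists (fun st => d st.1 st.2).
rewrite -(pair_bigA _ (fun s t => d s t ^+ (p ^ e.+1) * (x t ^+ p * y s))) /=.
apply: eq_bigr => s _; rewrite hd sumX mulr_suml; apply: eq_bigr => t _.
by rewrite exprMn_comm ?mulrA -?exprM ?expnSr //; apply: mulrC.
Qed.

(** * The structural map on an affine open set *)

Section StructuralMap.
Variables (p : nat) (X : scheme) (hX : char_space p X) (L : omodule X) (e : nat).
Variable M : cartier_module hX L e.
Local Notation O := (ssheaf X).
Local Notation q := (p ^ e)%N.

(** The structural map in the trivialization of [L] given by a generator [l]. *)
Definition trivialized (U : opens X) (l : L U) (m : M U) : M U :=
  cm_str M U (cm_pure M U m l).

Lemma trivialized_additive U (l : L U) : zmod_morphism (trivialized l).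
Proof.
move=> m m'; rewrite /trivialized.
have -> : cm_pure M U (m - m') l = cm_pure M U m l - cm_pure M U m' l.
  have := bil_linearl (cm_pure M) l (-1) m' m.
  by rewrite !scaleN1r [- m' + m]addrC => ->; rewrite addrC.
exact: raddfB.
Qed.

HB.instance Definition _ U (l : L U) :=
  GRing.isZmodMorphism.Build (M U) (M U) (trivialized l) (trivialized_additive l).

Lemma pureZl U (a : O U) (m : M U) (l : L U) :
  cm_pure M U (a *: m) l = a *: cm_pure M U m l.
Proof.
have h0 : cm_pure M U 0 l = 0.
  have := bil_linearl (cm_pure M) l 1 0 0; rewrite !scale1r addr0 => h.
  by apply: (addrI (cm_pure M U 0 l)); rewrite addr0.
by have := bil_linearl (cm_pure M) l a m 0; rewrite h0 !addr0.
Qed.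

Lemma pureZr U (a : O U) (m : M U) (l : L U) :
  cm_pure M U m (a *: l) = a *: cm_pure M U m l.
Proof.
have h0 : cm_pure M U m 0 = 0.
  have := bil_linearr (cm_pure M) m 1 0 0; rewrite !scale1r addr0 => h.
  by apply: (addrI (cm_pure M U m 0)); rewrite addr0.
by have := bil_linearr (cm_pure M) m a l 0; rewrite h0 !addr0.
Qed.

Lemma pure_suml U n (m : 'I_n -> M U) (l : L U) :
  cm_pure M U (\sum_i m i) l = \sum_i cm_pure M U (m i) l.
Proof.
apply: (big_morph (fun x => cm_pure M U x l)) => [x y|].
  by have := bil_linearl (cm_pure M) l 1 x y; rewrite !scale1r.
by rewrite -(scale0r 0) pureZl scale0r.
Qed.

Lemma trivializedZ U (l : L U) (a : O U) (m : M U) :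
  trivialized l (a ^+ q *: m) = a *: trivialized l m.
Proof.
rewrite /trivialized pureZl.
exact: (linearZ_LR (cm_str M U) a (cm_pure M U m l)).
Qed.

Lemma trivialized_res (U V : opens X) (s : V `<=` U) (l : L U) (m : M U) :
  mres s (trivialized l m) = trivialized (mres s l) (mres s m).
Proof. by rewrite /trivialized (bil_res (cm_pure M) s) -hom_res. Qed.

Section Submodule.
Variable G : forall U : opens X, set (M U).
Hypothesis hG : cartier_submodule G.

Let rG : restricts (@G). Proof. by case: hG => /submodule_restricts. Qed.

Lemma submodule_sections U : submod (@G U).
Proof.
case: rG => hD h0 _; apply/submodP; split=> // [x y Gx Gy|a x Gx].
  by rewrite -(scale1r x); apply: hD.
exact: restrictsZ.
Qed.

Lemma trivialized_stable U (l : L U) m : @G U m -> @G U (trivialized l m).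
Proof.
move=> Gm; case: hG => _ _; apply=> x Ux; exists U, (@subset_refl _ _).
split=> //; exists 1%N, (fun=> m), (fun=> l); split=> //.
by rewrite big_ord1; case: (@msec_presheaf X (cm_tensor M)) => ->.
Qed.

(** Local surjectivity gives surjectivity over an affine open set [D]: the
    multipliers of a section into the image form an ideal that vanishes nowhere
    on [D]. *)
Lemma trivialized_onto (D : opens X) (l : L D) : (0 < q)%N ->
  cartier_sub_surjective G -> affine_like D -> nullstellensatz D ->
  (forall (V : opens X) (s : V `<=` D),
     bijective (fun a : O V => a *: mres s l)) ->
  extends (@G) D -> torsion_on M D ->
  forall g, @G D g -> exists2 m, @G D m & trivialized l m = g.
Proof.
move=> q0 surj affD nullD bijl extG torD g Gg.
have sD := submodule_sections D.
have [|x|n [m Gm]] := nullD [set a | exists2 m, @G D m & trivialized l m = a *: g] 1.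
- split=> [|a b [m Gm hm] [m' Gm' hm']|a b [m Gm hm]].
  + exists 0; first by case: sD.
    by rewrite raddf0 scale0r.
  + exists (m + m'); first exact: (opsubD sD).
    by rewrite raddfD /= hm hm' scalerDl.
  + exists (a ^+ q *: m); first exact: (submodZ _ sD).
    by rewrite trivializedZ hm scalerA.
- move=> /nv_sub Dx.
  have [V [sV [t [Vx Gt ht]]]] := surj D g Gg x Dx.
  have [V1 [s1 [V1x [r [gi [li [Ggi tE]]]]]]] := Gt x Vx.
  have [basis _ _ _] := affD; have [h [hx hV1]] := basis x V1 Dx V1x.
  pose W := Opens (nv_open h).
  have sW1 : W `<=` V1 := hV1.
  have sW : W `<=` D := @nv_sub X D h.
  have sWV := subset_trans sW1 s1.
  have /choice [b hb] : forall i, exists b : O W, mres sW1 (li i) = b *: mres sW l.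
    by move=> i; have [inv _ hi] := bijl W sW; exists (inv (mres sW1 (li i))).
  pose g' : M W := \sum_i b i *: mres sW1 (gi i).
  have Gg' : @G W g'.
    apply: (submod_comb _ _ (submodule_sections W)) => i.
    by case: rG => _ _; apply.
  have str_g' : trivialized (mres sW l) g' = mres sW g.
    rewrite /trivialized pure_suml.
    have -> : \sum_i cm_pure M W (b i *: mres sW1 (gi i)) (mres sW l) = mres sWV t.
      rewrite -(mres_comp s1 sW1) tE raddf_sum; apply: eq_bigr => i _.
      by rewrite -(bil_res (cm_pure M) sW1) hb pureZl pureZr.
    have -> : cm_str M W (mres sWV t) = mres sWV (cm_str M V t).
      exact: (hom_res (cm_str M) sWV t).
    by rewrite ht (mres_comp sV sWV sW).
  have [k [m [Gm hm]]] := extG h W sW erefl g' Gg'.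
  pose m' := h ^+ (q * k - k) *: m.
  have Gm' : @G D m' by apply: (submodZ _ sD).
  have hm' : mres sW m' = (sres sW h ^+ k) ^+ q *: g'.
    rewrite mresZ -hm scalerA rmorphXn -exprD subnK ?leq_pmull //.
    by rewrite mulnC exprM.
  have [|j hj] := torD h W sW erefl (trivialized l m' - h ^+ k *: g).
    rewrite raddfB /= trivialized_res hm' trivializedZ str_g' mresZ rmorphXn.
    by rewrite subrr.
  exists (h ^+ (j + k)); last exact: nv_exp.
  exists ((h ^+ j) ^+ q *: m'); first exact: (submodZ _ sD).
  move/eqP: hj; rewrite scalerBr subr_eq0 => /eqP hj.
  by rewrite trivializedZ hj scalerA exprD.
- by rewrite expr1n scale1r => hm; exists m.
Qed.

Lemma submodule_extends (D : opens X) : affine_like D -> nullstellensatz D ->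
  extends (fun U => [set: M U]) D -> torsion_on M D -> extends (@G) D.
Proof.
move=> affD nullD extD torD; case: hG => sG cG _.
by apply: extends_local => // x _; apply: coherent_sub_affine.
Qed.

End Submodule.
End StructuralMap.

(** * Comparison of submodules *)

Section Compare.
Variables (X : scheme) (M : omodule X).
Implicit Types G : forall U : opens X, set (M U).

(** In this form inclusions can be glued over subsets of [X] and proved on affine
    open sets. *)
Definition locally_sub (A : set X) G G' : Prop :=
  forall (U : opens X) (m : M U) x, A x -> oset U x -> G U m ->
  exists (V : opens X) (s : V `<=` U), oset V x /\ G' V (mres s m).

Lemma locally_sub_affine (D : opens X) G G' : affine_like D ->
  restricts G -> restricts G' -> extends G D -> G D `<=` G' D ->
  locally_sub D G G'.
Proof.
move=> affD rG rG' extG sub U m x Dx Ux Gm.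
have [basis loc _ _] := affD.
have [h [hx hU]] := basis x U Dx Ux.
pose W := Opens (nv_open h).
have sU : W `<=` U := hU; have sD : W `<=` D := @nv_sub X D h.
exists W, sU; split=> //.
have [_ _ resG] := rG; have [_ _ resG'] := rG'.
have [n [m' [Gm' hm']]] := extG h W sD erefl (mres sU m) (resG _ _ sU _ Gm).
have [v hv] := localization_unit (loc h W sD erefl).
have -> : mres sU m = v ^+ n *: mres sD m'.
  by rewrite -hm' scalerA -exprMn_comm ?hv ?expr1n ?scale1r //; apply: mulrC.
by apply: restrictsZ => //; apply: resG'; apply: sub.
Qed.

Lemma locally_sub_trans A G1 G2 G3 G4 : (forall U, G1 U `<=` G2 U) ->
  (forall U, G3 U `<=` G4 U) -> locally_sub A G2 G3 -> locally_sub A G1 G4.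
Proof.
move=> h12 h34 hA U m x Ax Ux Gm.
have [V [s [Vx G3m]]] := hA U m x Ax Ux (h12 U m Gm).
by exists V, s; split=> //; apply: h34.
Qed.

Lemma locally_sub_subset A B G G' :
  A `<=` B -> locally_sub B G G' -> locally_sub A G G'.
Proof. by move=> AB h U m x /AB; apply: h. Qed.

Lemma locally_subU A B G G' :
  locally_sub A G G' -> locally_sub B G G' -> locally_sub (A `|` B) G G'.
Proof. by move=> hA hB U m x [Ax|Bx]; [apply: hA|apply: hB]. Qed.

Lemma locally_sub_eq G G' : is_submodule G' -> (forall U, G' U `<=` G U) ->
  locally_sub setT G G' -> G = G'.
Proof.
move=> [_ _ _ glue] sub h; apply/functional_extensionality_dep => U.
apply/seteqP; split=> [m Gm|]; last exact: sub.
by apply: glue => x Ux; apply: h.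
Qed.

End Compare.

Lemma geometric_induction (p : nat) (k : fieldType) (hp : p \in [pchar k])
  (hk : perfect_field p k) (X : scheme)
  (f : {rmorphism k -> ssheaf X (opens_top X)}) (hX : geometric_scheme f)
  (Q : set X -> Prop) : Q set0 ->
  (forall A B, A `<=` B -> Q B -> Q A) ->
  (forall A B, Q A -> Q B -> Q (A `|` B)) ->
  (forall x, exists V : opens X, oset V x /\ Q V) -> Q setT.
Proof.
move=> Q0 Qm QU Qloc; have [n [U [cover charts geom]]] := hX.
have QUi i : Q (U i).
  have [c] := charts i; have top : U i `<=` opens_top X by [].
  have [_ nU _] := geometric_algebra_noetherian_ffinite hp hk (geom i top).
  apply: affine_induction => //; first exact: chart_affine_like c.
  exact: chart_nullstellensatz c nU.
have Qlt m : Q (\bigcup_(i in [set i : 'I_n | (i < m)%N]) U i).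
  elim: m => [|m IH]; first by apply: Qm Q0 => x [i].
  have [mn|nm] := ltnP m n; last first.
    apply: Qm IH => x [i _ Uix]; exists i => //=.
    exact: leq_trans (ltn_ord i) nm.
  apply: Qm (QU _ _ IH (QUi (Ordinal mn))) => x [i].
  rewrite /= ltnS leq_eqVlt => /orP[/eqP im|im] Uix; last by left; exists i.
  by right; rewrite (_ : Ordinal mn = i) //; apply: val_inj.
apply: Qm (Qlt n) => x /cover [i _ Uix]; exists i => //=.
Qed.

Theorem theorem8p15 (p : nat) (k : fieldType) (hp : p \in [pchar k])
  (hk : perfect_field p k)
  (X : scheme) (f : {rmorphism k -> ssheaf X (opens_top X)})
  (hX : geometric_scheme f)
  (L : omodule X) (hL : line_bundle L)
  (e : nat) (he : (0 < e)%N)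
  (M : cartier_module (char_space_of_field f hp) L e)
  (Fs : int -> forall U : opens X, set (M U))
  (hFs : forall i : int, cartier_submodule (Fs i))
  (hchain : forall (i : int) (U : opens X), Fs (i + 1) U `<=` Fs i U)
  (hsurj : forall i : int, cartier_sub_surjective (Fs i)) :
  (exists N : int, forall i : int, N <= i -> Fs i = Fs N) /\
  (exists N : int, forall i : int, i <= N -> Fs i = Fs N).
Proof.
have p_prime : prime p by case/andP: (hp).
have q_gt1 : (1 < p ^ e)%N by rewrite -{1}(exp1n e) ltn_exp2r // prime_gt1.
have sF i : is_submodule (Fs i) by case: (hFs i).
have rF i := submodule_restricts (sF i).
have Fle (i j : int) U : i <= j -> Fs j U `<=` Fs i U.
  move=> ij; have -> : j = i + `|j - i|%N by lia.
  elim: `|j - i|%N => [|n IH]; first by rewrite addr0.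
  rewrite -addn1 PoszD addrA; exact: subset_trans (hchain _ U) IH.
have extF (D : opens X) i : affine_like D -> nullstellensatz D ->
    extends (fun U => [set: M U]) D -> torsion_on M D -> extends (Fs i) D.
  by move=> *; apply: (submodule_extends (hFs i)).
have good := good_neighbourhood hp hk hX hL (cm_coherent M).
have desc x : exists D : opens X, oset D x /\
    exists N : nat, forall i : int, N%:Z <= i -> locally_sub D (Fs N%:Z) (Fs i).
  have [D [l [Dx [affD nullD] bijl [extD torD] [nO fO accD]]]] := good x.
  exists D; split=> //.
  have pO : p%:R = 0 :> ssheaf X D by case: (char_space_of_field f hp).
  have [|N hN] := @cartier_chain_stationary _ _
    (frobenius_rmorphism e p_prime pO) q_gt1 (fun=> erefl) nO
    (ffinite_exp e p_prime pO fO) (M D) (trivialized l)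
    (trivializedZ l) accD (fun n => Fs n%:Z D).
  - split=> [n|n|n m|n m].
    + exact: submodule_sections.
    + by rewrite -addn1 PoszD; apply: hchain.
    + exact: trivialized_stable.
    + apply: trivialized_onto => //; first exact: ltnW.
      exact: extF.
  exists N => i Ni; apply: locally_sub_affine => //; first exact: extF.
  by have -> : i = `|i|%N by lia.
have asc x : exists D : opens X, oset D x /\ exists N : nat,
    forall i : int, i <= - N%:Z -> locally_sub D (Fs i) (Fs (- N%:Z)).
  have [D [l [Dx [affD nullD] bijl [extD torD] [nO fO accD]]]] := good x.
  exists D; split=> //.
  have [||//|N hN] := accD (fun n => Fs (- n%:Z) D).
  - by move=> n; apply: submodule_sections.
  - by move=> n; apply: Fle; lia.
  exists N => i Ni; apply: locally_sub_affine => //; first exact: extF.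
  by have -> : i = - `|i|%N%:Z by lia.
split.
- have [|||N hN] := @geometric_induction p k hp hk X f hX
    (fun A => exists N : nat, forall i : int, N%:Z <= i ->
       locally_sub A (Fs N%:Z) (Fs i)) _ _ _ desc.
  + by exists 0%N => i _ U m x.
  + move=> A B AB [N hN]; exists N => i Ni.
    by apply: locally_sub_subset AB _; apply: hN.
  + move=> A B [N hN] [N' hN']; exists (maxn N N') => i Ni.
    apply: locally_subU.
    * apply: (locally_sub_trans _ (fun U => @subset_refl _ _) (hN i _)) => [U|].
        by apply: Fle; lia.
      by lia.
    * apply: (locally_sub_trans _ (fun U => @subset_refl _ _) (hN' i _)) => [U|].
        by apply: Fle; lia.
      by lia.
  exists N%:Z => i Ni; apply/esym/locally_sub_eq => // [U|]; first exact: Fle.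
  exact: hN.
- have [|||N hN] := @geometric_induction p k hp hk X f hX
    (fun A => exists N : nat, forall i : int, i <= - N%:Z ->
       locally_sub A (Fs i) (Fs (- N%:Z))) _ _ _ asc.
  + by exists 0%N => i _ U m x.
  + move=> A B AB [N hN]; exists N => i Ni.
    by apply: locally_sub_subset AB _; apply: hN.
  + move=> A B [N hN] [N' hN']; exists (maxn N N') => i Ni.
    apply: locally_subU.
    * apply: (locally_sub_trans (fun U => @subset_refl _ _) _ (hN i _)) => [U|].
        by apply: Fle; lia.
      by lia.
    * apply: (locally_sub_trans (fun U => @subset_refl _ _) _ (hN' i _)) => [U|].
        by apply: Fle; lia.
      by lia.
  exists (- N%:Z) => i Ni; apply: locally_sub_eq => // [U|]; first exact: Fle.
  exact: hN.
Qed.
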